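(* There exist a decreasing sequence $(a_n)_{n\ge 1}$ of real numbers with $$0<\dots<a_n<a_{n-1}<\dots<a_1=\frac{1+\sqrt3}{3\sqrt3+5}$$ and, for every integer $n\ge 1$, a smooth stationary (i.e. time-independent) solution $W_n$ of the equation $$\partial_t^2 W-\partial_x^2W+P\,W(W^2-1)=0$$ (that is, a smooth function $W_n:\mathbb R\to\mathbb R$ of $x$ with $-W_n''+PW_n(W_n^2-1)=0$) such that $$-1\le W_n\le 1,\qquad \lim_{x\to-\infty}W_n(x)=a_n,\qquad \lim_{x\to\infty}W_n(x)=(-1)^n,$$ and $W_n$ has exactly $n$ zeros.
   Context: Let $m>0$ (mass of the Schwarzschild black hole). The variable $r\in(2m,\infty)$ and the variable $x\in\mathbb R$ are related by $\frac{dx}{dr}=\left(1-\frac{2m}{r}\right)^{-1}$, so that $x\to-\infty$ corresponds to $r\to 2m$ and $x\to+\infty$ to $r\to\infty$. Here $P=\frac{1-\frac{2m}{r}}{r^2}$, regarded as a function of $x$ through $r=r(x)$, and $'=\partial_x$. *)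

(* Defs.v *)
(* Stdlib's real numbers with Coquelicot. *)
From Stdlib Require Import Reals List.
From Coquelicot Require Import Coquelicot.
Open Scope R_scope.

(* [r] is the area radius as a function of the tortoise coordinate: the inverse
   of a bijection [xs] from (2m, +oo) onto R with dxs/dr = (1 - 2m/r)^-1.
   Such an [xs] is determined only up to an additive constant, which is left
   arbitrary; its values outside (2m, +oo) are irrelevant. *)
Definition tortoise_radius (m : R) (r : R -> R) : Prop :=
  exists xs : R -> R,
    (forall rho : R, 2 * m < rho -> is_derive xs rho (/ (1 - 2 * m / rho))) /\
    (forall rho : R, 2 * m < rho -> r (xs rho) = rho) /\
    (forall x : R, 2 * m < r x /\ xs (r x) = x).

Definition P (m : R) (r : R -> R) (x : R) : R :=
  (1 - 2 * m / r x) / (r x) ^ 2.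

(* Coquelicot's [Derive_n] is total, so this is meaningful only for [u] twice
   differentiable in each variable; use it together with [smooth]. *)
Definition yang_mills_equation (m : R) (r : R -> R) (u : R -> R -> R) : Prop :=
  forall t x : R,
    Derive_n (fun s => u s x) 2 t - Derive_n (fun y => u t y) 2 x
      + P m r x * (u t x * ((u t x) ^ 2 - 1)) = 0.

Definition smooth (f : R -> R) : Prop :=
  forall (k : nat) (x : R), ex_derive_n f k x.

Definition smooth_stationary_solution (m : R) (r : R -> R) (W : R -> R) : Prop :=
  smooth W /\ yang_mills_equation m r (fun _ x => W x).

Definition has_exactly_n_zeros (f : R -> R) (n : nat) : Prop :=
  exists l : list R,
    NoDup l /\ length l = n /\ (forall x : R, In x l <-> f x = 0).

(* Main.v *)
Require Import Defs.
From Stdlib Require Import Reals List.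
From Coquelicot Require Import Coquelicot.
From Stdlib Require Import Lra Lia ClassicalEpsilon.
Open Scope R_scope.

(** In the variable [s = r/(2m) - 1] the static equation is the system [w' = (1+s)/s v],
    [v' = (w^3 - w)/(1+s)^2], regular-singular at the horizon [s = 0], and has a unique solution
    with [w(0) = a], [v(0) = 0], depending continuously on [a]. Its Pruefer angle starts at 0,
    increases while [|w| < 1], depends continuously on [a] and counts the zeros of [w].
    Having at least [k] zeros before leaving [(-1,1)] is an open condition on [a]. Near a value
    [a] whose solution leaves [(-1,1)] the number of zeros does not increase; near a value whose
    solution stays in [(-1,1)] with [k] zeros, and hence tends to [(-1)^k], it is at most [k+1],
    because a solution that turns back far out has gained positive energy before it can turn
    again. As [a -> 0] the number of zeros tends to infinity. Hence, below a value [a_n] with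
    exactly [n] zeros, the supremum of the values with at least [n+2] zeros is a value whose
    solution stays in [(-1,1)] and has exactly [n+1] zeros. The explicit solution
    [w = (c - rho)/(rho + 3(c-1))], [rho = 1 + s], [c = (3 + sqrt 3)/2] starts the induction. *)

(** * Mean value inequalities *)

(** The factor [(1+s)/s] is singular at the starting point, so the Picard-Lindelof theorem does not
    apply as it stands. The estimate [|v| <= s], which survives every iteration, cancels the
    singularity, and a weight makes the iteration contract on the whole half-line at once. The cubic
    is cut off outside [-1,1] so that all solutions are global and comparable at every [s]; [turns]
    and [good] only see the part of a solution inside the strip, where the cut-off is invisible.
    Zeros are counted through the angle because a strict inequality for the angle at one point is
    stable under small changes of [a]. The hard case is a trapped solution: it lives on an unbounded
    interval, where continuous dependence says nothing, so a nearby solution might acquire many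
    zeros far out. The energy argument excludes this only up to one extra zero; this is why the
    supremum is taken over [n+2] and not over [n+1] zeros. *)

Lemma is_derive_continuity_pt (f : R -> R) (x l : R) :
  is_derive f x l -> continuity_pt f x.
Proof.
  intros H. apply derivable_continuous_pt. exists l. now apply is_derive_Reals.
Qed.

Lemma is_derive_Rplus (f h : R -> R) (x l k : R) :
  is_derive f x l -> is_derive h x k -> is_derive (fun y => f y + h y) x (l + k).
Proof. exact (is_derive_plus f h x l k). Qed.

Lemma is_derive_Rminus (f h : R -> R) (x l k : R) :
  is_derive f x l -> is_derive h x k -> is_derive (fun y => f y - h y) x (l - k).
Proof. exact (is_derive_minus f h x l k). Qed.

Lemma is_derive_Rscal (f : R -> R) (x l c : R) :
  is_derive f x l -> is_derive (fun y => c * f y) x (c * l).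
Proof. intros H. exact (is_derive_scal f x c l H). Qed.

Lemma continuity_pt_inv_fun (f : R -> R) (x : R) :
  continuity_pt f x -> f x <> 0 -> continuity_pt (fun y => / f y) x.
Proof. exact (continuity_pt_inv f x). Qed.

Lemma continuity_pt_fun_plus (f h : R -> R) (x : R) :
  continuity_pt f x -> continuity_pt h x -> continuity_pt (fun y => f y + h y) x.
Proof. exact (continuity_pt_plus f h x). Qed.

Lemma continuity_pt_fun_minus (f h : R -> R) (x : R) :
  continuity_pt f x -> continuity_pt h x -> continuity_pt (fun y => f y - h y) x.
Proof. exact (continuity_pt_minus f h x). Qed.

Lemma continuity_pt_fun_opp (f : R -> R) (x : R) :
  continuity_pt f x -> continuity_pt (fun y => - f y) x.
Proof. exact (continuity_pt_opp f x). Qed.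

Lemma continuity_pt_fun_mult (f h : R -> R) (x : R) :
  continuity_pt f x -> continuity_pt h x -> continuity_pt (fun y => f y * h y) x.
Proof. exact (continuity_pt_mult f h x). Qed.

Lemma continuity_pt_fun_comp (f h : R -> R) (x : R) :
  continuity_pt f x -> continuity_pt h (f x) -> continuity_pt (fun y => h (f y)) x.
Proof. exact (continuity_pt_comp f h x). Qed.

Lemma continuity_pt_fun_const (c x : R) : continuity_pt (fun _ => c) x.
Proof. apply continuity_pt_const. now intros ? ?. Qed.

Lemma continuity_pt_fun_id (x : R) : continuity_pt (fun y => y) x.
Proof. exact (derivable_continuous_pt _ _ (derivable_pt_id x)). Qed.

Lemma continuity_pt_fun_pow (f : R -> R) (n : nat) (x : R) :
  continuity_pt f x -> continuity_pt (fun y => f y ^ n) x.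
Proof.
  intros H. induction n as [|n IH]; simpl.
  - apply continuity_pt_fun_const.
  - now apply continuity_pt_fun_mult.
Qed.

Ltac cont :=
  repeat match goal with
  | |- continuity_pt (fun y => y) _ => apply continuity_pt_fun_id
  | |- continuity_pt (fun _ => ?c) _ => apply continuity_pt_fun_const
  | |- continuity_pt (fun y => @?f y + @?h y) ?x => apply (continuity_pt_fun_plus f h x)
  | |- continuity_pt (fun y => @?f y - @?h y) ?x => apply (continuity_pt_fun_minus f h x)
  | |- continuity_pt (fun y => - @?f y) ?x => apply (continuity_pt_fun_opp f x)
  | |- continuity_pt (fun y => @?f y * @?h y) ?x => apply (continuity_pt_fun_mult f h x)
  | |- continuity_pt (fun y => @?f y / @?h y) ?x =>
      apply (continuity_pt_fun_mult f (fun y => / h y) x)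
  | |- continuity_pt (fun y => / @?f y) ?x => apply (continuity_pt_inv_fun f x)
  | |- continuity_pt (fun y => @?f y ^ ?n) ?x => apply (continuity_pt_fun_pow f n x)
  end; auto.

Lemma continuity_pt_eps (f : R -> R) (x : R) :
  continuity_pt f x <->
  (forall e, 0 < e -> exists d, 0 < d /\ forall y, Rabs (y - x) < d -> Rabs (f y - f x) < e).
Proof.
  split.
  - intros H e he. destruct (H e he) as [d [hd Hd]]. exists d. split; [exact hd|].
    intros y hy. destruct (Req_dec y x) as [->|hne].
    + now rewrite Rminus_diag, Rabs_R0.
    + apply (Hd y). split; [|exact hy]. split; [exact I|]. now apply not_eq_sym.
  - intros H e he. destruct (H e he) as [d [hd Hd]]. exists d. split; [exact hd|].
    intros y [_ hy]. now apply Hd.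
Qed.

(** Differentiability is asked only in the open interval because solutions of the system are merely
    continuous at the singular point [s = 0]. *)
Lemma mean_value_open (f f' : R -> R) (x y : R) :
  x < y ->
  (forall t, x <= t <= y -> continuity_pt f t) ->
  (forall t, x < t < y -> is_derive f t (f' t)) ->
  exists c, x < c < y /\ f y - f x = f' c * (y - x).
Proof.
  intros hxy hc hd.
  assert (pr1 : forall c, x < c < y -> derivable_pt f c).
  { intros c hcc. exists (f' c). apply is_derive_Reals. now apply hd. }
  destruct (MVT f id x y pr1 (fun c _ => derivable_pt_id c) hxy hc
              (fun c _ => derivable_continuous_pt _ _ (derivable_pt_id c))) as [c [hcc E]].
  exists c. split; [exact hcc|].
  rewrite derive_pt_id in E.
  rewrite (derive_pt_eq_0 f c (f' c) (pr1 c hcc)) in E.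
  - unfold id in E. lra.
  - apply is_derive_Reals. now apply hd.
Qed.

Lemma nondecreasing_of_derive (f f' : R -> R) (x y : R) :
  x <= y ->
  (forall t, x <= t <= y -> continuity_pt f t) ->
  (forall t, x < t < y -> is_derive f t (f' t)) ->
  (forall t, x < t < y -> 0 <= f' t) ->
  f x <= f y.
Proof.
  intros [hxy|<-] hc hd hp; [|lra].
  destruct (mean_value_open f f' x y hxy hc hd) as [c [hcc E]].
  specialize (hp c hcc). nra.
Qed.

Lemma increasing_of_derive (f f' : R -> R) (x y : R) :
  x < y ->
  (forall t, x <= t <= y -> continuity_pt f t) ->
  (forall t, x < t < y -> is_derive f t (f' t)) ->
  (forall t, x < t < y -> 0 < f' t) ->
  f x < f y.
Proof.
  intros hxy hc hd hp.
  destruct (mean_value_open f f' x y hxy hc hd) as [c [hcc E]].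
  specialize (hp c hcc). nra.
Qed.

(** Both [h - f] and [h + f] are nondecreasing. *)
Lemma derive_bound (f f' h h' : R -> R) (x y : R) :
  x <= y ->
  (forall t, x <= t <= y -> continuity_pt f t) ->
  (forall t, x <= t <= y -> continuity_pt h t) ->
  (forall t, x < t < y -> is_derive f t (f' t)) ->
  (forall t, x < t < y -> is_derive h t (h' t)) ->
  (forall t, x < t < y -> Rabs (f' t) <= h' t) ->
  Rabs (f y - f x) <= h y - h x.
Proof.
  intros hxy cf ch df dh hb.
  assert (A : h x - f x <= h y - f y).
  { apply (nondecreasing_of_derive (fun t => h t - f t) (fun t => h' t - f' t)); trivial.
    - intros t ht. cont.
    - intros t ht. apply is_derive_Rminus; auto.
    - intros t ht. specialize (hb t ht). apply Rabs_le_between in hb. lra. }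
  assert (B : h x + f x <= h y + f y).
  { apply (nondecreasing_of_derive (fun t => h t + f t) (fun t => h' t + f' t)); trivial.
    - intros t ht. cont.
    - intros t ht. apply is_derive_Rplus; auto.
    - intros t ht. specialize (hb t ht). apply Rabs_le_between in hb. lra. }
  apply Rabs_le. lra.
Qed.

Lemma intermediate_value (f : R -> R) (x y c : R) :
  x <= y -> (forall t, x <= t <= y -> continuity_pt f t) ->
  f x <= c <= f y -> exists z, x <= z <= y /\ f z = c.
Proof.
  intros [hxy|<-] hc hv; [|exists x; lra].
  destruct (Req_dec (f x) c) as [e|ne]; [exists x; lra|].
  destruct (Req_dec (f y) c) as [e|ne']; [exists y; lra|].
  destruct (Ranalysis5.IVT_interv (fun t => f t - c) x y) as [z [hz e]]; try lra.
  - intros t ht. cont.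
  - exists z. split; [exact hz|lra].
Qed.

(** * The system in the variable s *)

(* The cubic [w^3 - w] on [-1,1], continued by zero to a globally Lipschitz function. *)
Definition clip (w : R) : R := Rmax (-1) (Rmin 1 w).
Definition g (w : R) : R := clip w ^ 3 - clip w.

Lemma clip_cases (w : R) :
  (w <= -1 /\ clip w = -1) \/ (-1 <= w <= 1 /\ clip w = w) \/ (1 <= w /\ clip w = 1).
Proof.
  unfold clip.
  destruct (Rle_lt_dec w 1).
  - rewrite Rmin_right by lra. destruct (Rle_lt_dec w (-1)).
    + rewrite Rmax_left; lra.
    + rewrite Rmax_right; lra.
  - rewrite Rmin_left by lra. rewrite Rmax_right; lra.
Qed.

Lemma clip_range (w : R) : -1 <= clip w <= 1.
Proof. destruct (clip_cases w) as [[h ->]|[[h ->]|[h ->]]]; lra. Qed.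

Lemma clip_id (w : R) : -1 <= w <= 1 -> clip w = w.
Proof. intros h. destruct (clip_cases w) as [[h' ->]|[[h' ->]|[h' ->]]]; lra. Qed.

Lemma clip_lipschitz (x y : R) : Rabs (clip x - clip y) <= Rabs (x - y).
Proof.
  destruct (clip_cases x) as [[h ->]|[[h ->]|[h ->]]];
  destruct (clip_cases y) as [[k ->]|[[k ->]|[k ->]]];
  unfold Rabs; repeat destruct Rcase_abs; lra.
Qed.

Lemma g_inside (w : R) : -1 <= w <= 1 -> g w = w ^ 3 - w.
Proof. intros h. unfold g. now rewrite clip_id. Qed.

(** The constant comes from [x^2 + x y + y^2 - 1], which lies in [-1,2] on the square [-1,1]^2. *)
Lemma g_lipschitz (x y : R) : Rabs (g x - g y) <= 2 * Rabs (x - y).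
Proof.
  unfold g.
  replace (clip x ^ 3 - clip x - (clip y ^ 3 - clip y))
    with ((clip x ^ 2 + clip x * clip y + clip y ^ 2 - 1) * (clip x - clip y)) by ring.
  rewrite Rabs_mult.
  apply Rmult_le_compat; try apply Rabs_pos; [|apply clip_lipschitz].
  pose proof (clip_range x). pose proof (clip_range y).
  apply Rabs_le. nra.
Qed.

Lemma g_bounded (w : R) : Rabs (g w) <= 1.
Proof.
  pose proof (clip_range w). unfold g. apply Rabs_le.
  assert (0 <= 1 - clip w ^ 2 <= 1) by nra. split; nra.
Qed.

(** This sign is what makes the Pruefer angle monotone. *)
Lemma g_sign (w : R) : w * g w <= 0.
Proof.
  pose proof (clip_range w) as H.
  assert (S : 0 <= w * clip w).
  { destruct (clip_cases w) as [[h ->]|[[h ->]|[h ->]]]; nra. }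
  unfold g. replace (w * (clip w ^ 3 - clip w)) with (- ((w * clip w) * (1 - clip w ^ 2))) by ring.
  assert (0 <= 1 - clip w ^ 2) by nra. nra.
Qed.

Lemma g_continuity (x : R) : continuity_pt g x.
Proof.
  apply continuity_pt_eps. intros e he. exists (e / 2). split; [lra|].
  intros y hy. pose proof (g_lipschitz y x). lra.
Qed.

(* The static equation in the variable [s = r/(2m) - 1], as a first order system for
   [w] and [v = (1 - 2m/r) w_r]; the nonlinearity is evaluated at [f], so that [f = w]
   for a solution and [step a f w v] is one Picard iteration in general. *)
Definition step (a : R) (f w v : R -> R) : Prop :=
  w 0 = a /\ v 0 = 0 /\
  (forall s, 0 <= s -> continuity_pt w s) /\
  (forall s, 0 <= s -> continuity_pt v s) /\
  (forall s, 0 < s -> is_derive v s (g (f s) / (1 + s) ^ 2)) /\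
  (forall s, 0 < s -> is_derive w s ((1 + s) / s * v s)).

(* Chosen so that [weight' = 4 (1 + s) weight]: one Picard step halves weighted distances. *)
Definition weight (s : R) : R := exp (4 * s + 2 * s ^ 2).

Lemma weight_ge (s : R) : 0 <= s -> 1 + (4 * s + 2 * s ^ 2) <= weight s.
Proof. intros h. unfold weight. apply exp_ineq1_le. Qed.

Lemma weight_derive (s : R) : is_derive weight s (4 * (1 + s) * weight s).
Proof. unfold weight. auto_derive; trivial. simpl. ring. Qed.

Lemma weight_continuity (s : R) : continuity_pt weight s.
Proof. exact (is_derive_continuity_pt _ _ _ (weight_derive s)). Qed.

Lemma weight_mono (s t : R) : 0 <= s <= t -> weight s <= weight t.
Proof.
  intros h. unfold weight. destruct (Req_dec s t) as [->|hne]; [lra|].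
  left. apply exp_increasing. nra.
Qed.

(** * Weighted comparison of two Picard steps *)

(** The weight is frozen at the right endpoint so that the majorant is linear; the factor [s] gained
    in this way is what compensates [(1+s)/s] in the equation for [w]. *)
Lemma step_v_diff (a1 a2 : R) (f1 f2 w1 v1 w2 v2 : R -> R) (M s : R) :
  step a1 f1 w1 v1 -> step a2 f2 w2 v2 -> 0 <= s ->
  (forall t, 0 <= t <= s -> Rabs (f1 t - f2 t) <= M * weight t) -> 0 <= M ->
  Rabs (v1 s - v2 s) <= 2 * M * weight s * s.
Proof.
  intros [_ [z1 [_ [cv1 [dv1 _]]]]] [_ [z2 [_ [cv2 [dv2 _]]]]] hs hb hM.
  assert (H : Rabs ((fun t => v1 t - v2 t) s - (fun t => v1 t - v2 t) 0)
              <= (fun t => 2 * M * weight s * t) s - (fun t => 2 * M * weight s * t) 0).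
  { apply (derive_bound (fun t => v1 t - v2 t)
             (fun t => g (f1 t) / (1 + t) ^ 2 - g (f2 t) / (1 + t) ^ 2)
             (fun t => 2 * M * weight s * t) (fun _ => 2 * M * weight s)); trivial.
    - intros t ht. cont; [apply cv1|apply cv2]; lra.
    - intros t ht. cont.
    - intros t ht. apply is_derive_Rminus; [apply dv1|apply dv2]; lra.
    - intros t ht. auto_derive; trivial. ring.
    - intros t ht.
      replace (g (f1 t) / (1 + t) ^ 2 - g (f2 t) / (1 + t) ^ 2)
        with ((g (f1 t) - g (f2 t)) * / (1 + t) ^ 2) by (field; lra).
      rewrite Rabs_mult.
      assert (hi : 0 < / (1 + t) ^ 2 <= 1).
      { split; [apply Rinv_0_lt_compat; nra|].
        rewrite <- Rinv_1. apply Rinv_le_contravar; nra. }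
      rewrite (Rabs_pos_eq (/ _)) by lra.
      pose proof (g_lipschitz (f1 t) (f2 t)) as hl.
      assert (hm : M * weight t <= M * weight s).
      { apply Rmult_le_compat_l; trivial. apply weight_mono. lra. }
      specialize (hb t). pose proof (Rabs_pos (g (f1 t) - g (f2 t))).
      apply Rle_trans with (Rabs (g (f1 t) - g (f2 t)) * 1).
      + apply Rmult_le_compat_l; lra.
      + lra. }
  simpl in H. rewrite z1, z2 in H. rewrite Rminus_0_r, Rminus_0_r, Rmult_0_r, Rminus_0_r in H.
  exact H.
Qed.

(** The factor [s] in the bound for [v] cancels the singularity and leaves [2 M (1+s) weight], which
    is exactly the derivative of [M/2 weight]. *)
Lemma step_w_diff (a1 a2 : R) (f1 f2 w1 v1 w2 v2 : R -> R) (M s : R) :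
  step a1 f1 w1 v1 -> step a2 f2 w2 v2 -> 0 <= s ->
  (forall t, 0 <= t <= s -> Rabs (f1 t - f2 t) <= M * weight t) -> 0 <= M ->
  Rabs (w1 s - w2 s) <= Rabs (a1 - a2) + M / 2 * weight s.
Proof.
  intros S1 S2 hs hb hM.
  pose proof S1 as [i1 [_ [cw1 [_ [_ dw1]]]]]. pose proof S2 as [i2 [_ [cw2 [_ [_ dw2]]]]].
  assert (H : Rabs ((fun t => w1 t - w2 t) s - (fun t => w1 t - w2 t) 0)
              <= (fun t => M / 2 * weight t) s - (fun t => M / 2 * weight t) 0).
  { apply (derive_bound (fun t => w1 t - w2 t)
             (fun t => (1 + t) / t * v1 t - (1 + t) / t * v2 t)
             (fun t => M / 2 * weight t) (fun t => M / 2 * (4 * (1 + t) * weight t))); trivial.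
    - intros t ht. cont; [apply cw1|apply cw2]; lra.
    - intros t ht. cont. apply weight_continuity.
    - intros t ht. apply is_derive_Rminus; [apply dw1|apply dw2]; lra.
    - intros t ht. apply is_derive_Rscal. apply weight_derive.
    - intros t ht.
      assert (hv : Rabs (v1 t - v2 t) <= 2 * M * weight t * t).
      { apply (step_v_diff a1 a2 f1 f2 w1 v1 w2 v2); trivial; [lra|].
        intros u hu. apply hb. lra. }
      replace ((1 + t) / t * v1 t - (1 + t) / t * v2 t)
        with ((1 + t) / t * (v1 t - v2 t)) by (field; lra).
      assert (hp : 0 < (1 + t) / t) by (apply Rdiv_lt_0_compat; lra).
      rewrite Rabs_mult, (Rabs_pos_eq ((1 + t) / t)) by lra.
      replace (M / 2 * (4 * (1 + t) * weight t)) with ((1 + t) / t * (2 * M * weight t * t))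
        by (field; lra).
      apply Rmult_le_compat_l; lra. }
  simpl in H. rewrite i1, i2 in H.
  replace (w1 s - w2 s) with ((w1 s - w2 s - (a1 - a2)) + (a1 - a2)) by ring.
  eapply Rle_trans; [apply Rabs_triang|].
  pose proof (weight_ge 0). assert (0 <= M / 2 * weight 0) by (apply Rmult_le_pos; lra). lra.
Qed.

Lemma step_v_bound (a : R) (f w v : R -> R) (s : R) :
  step a f w v -> 0 <= s -> Rabs (v s) <= s.
Proof.
  intros [_ [z [_ [cv [dv _]]]]] hs.
  assert (H : Rabs (v s - v 0) <= (fun t => t) s - (fun t => t) 0).
  { apply (derive_bound v (fun t => g (f t) / (1 + t) ^ 2) (fun t => t) (fun _ => 1)); trivial.
    - intros t ht. apply cv. lra.
    - intros t ht. cont.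
    - intros t ht. apply dv. lra.
    - intros t ht. auto_derive; trivial.
    - intros t ht. unfold Rdiv. rewrite Rabs_mult.
      assert (hi : 0 < / (1 + t) ^ 2 <= 1).
      { split; [apply Rinv_0_lt_compat; nra|].
        rewrite <- Rinv_1. apply Rinv_le_contravar; nra. }
      rewrite (Rabs_pos_eq (/ _)) by lra.
      pose proof (g_bounded (f t)). pose proof (Rabs_pos (g (f t))). nra. }
  simpl in H. rewrite z, Rminus_0_r, Rminus_0_r in H. exact H.
Qed.

(** Integrating [|v| <= s] gives the crude bound [s + s^2/2]; it is put in terms of the weight so
    that it can start the halving argument. *)
Lemma step_w_bound (a : R) (f w v : R -> R) (s : R) :
  step a f w v -> 0 <= s -> Rabs (w s - a) <= weight s.
Proof.
  intros S hs. pose proof S as [i [_ [cw [_ [_ dw]]]]].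
  assert (H : Rabs (w s - w 0) <= (fun t => t + t ^ 2 / 2) s - (fun t => t + t ^ 2 / 2) 0).
  { apply (derive_bound w (fun t => (1 + t) / t * v t) (fun t => t + t ^ 2 / 2)
             (fun t => 1 + t)); trivial.
    - intros t ht. apply cw. lra.
    - intros t ht. cont.
    - intros t ht. apply dw. lra.
    - intros t ht. auto_derive; trivial. field.
    - intros t ht. pose proof (step_v_bound a f w v t S ltac:(lra)) as hv.
      assert (hp : 0 < (1 + t) / t) by (apply Rdiv_lt_0_compat; lra).
      rewrite Rabs_mult, (Rabs_pos_eq ((1 + t) / t)) by lra.
      replace (1 + t) with ((1 + t) / t * t) at 2 by (field; lra).
      apply Rmult_le_compat_l; lra. }
  simpl in H. rewrite i in H. pose proof (weight_ge s hs). nra.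
Qed.

(** A solution is a fixed point of the Picard step, so a bound [M weight] for the difference
    improves to [(d + M/2) weight]. Repeating this from the crude bound converges to [2 d weight].
    With equal initial values it is uniqueness. *)
Lemma solution_diff (a1 a2 : R) (w1 v1 w2 v2 : R -> R) (s : R) :
  step a1 w1 w1 v1 -> step a2 w2 w2 v2 -> 0 <= s ->
  Rabs (w1 s - w2 s) <= 2 * Rabs (a1 - a2) * weight s.
Proof.
  intros S1 S2. set (d := Rabs (a1 - a2)).
  assert (hd : 0 <= d) by apply Rabs_pos.
  assert (K : forall k s, 0 <= s ->
    Rabs (w1 s - w2 s) <= (2 * d + (2 + d) * (/ 2) ^ k) * weight s).
  { induction k as [|k IH]; intros t ht.
    - pose proof (step_w_bound a1 w1 w1 v1 t S1 ht).
      pose proof (step_w_bound a2 w2 w2 v2 t S2 ht).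
      replace (w1 t - w2 t) with ((w1 t - a1) - (w2 t - a2) + (a1 - a2)) by ring.
      eapply Rle_trans; [apply Rabs_triang|].
      eapply Rle_trans; [apply Rplus_le_compat_r; apply Rabs_triang|].
      rewrite Rabs_Ropp. simpl. fold d. pose proof (weight_ge t ht). nra.
    - assert (hk : 0 <= (/ 2) ^ k) by (apply pow_le; lra).
      eapply Rle_trans.
      + apply (step_w_diff a1 a2 w1 w2 w1 v1 w2 v2 (2 * d + (2 + d) * (/ 2) ^ k)); trivial.
        * intros u hu. apply IH. lra.
        * nra.
      + fold d. simpl. pose proof (weight_ge t ht). nra. }
  intros hs. pose proof (weight_ge s hs).
  apply (is_lim_seq_le (fun _ => Rabs (w1 s - w2 s))
           (fun k => (2 * d + (2 + d) * (/ 2) ^ k) * weight s)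
           (Rabs (w1 s - w2 s)) (2 * d * weight s)).
  - intros k. now apply K.
  - apply is_lim_seq_const.
  - replace (Finite (2 * d * weight s)) with (Finite ((2 * d + (2 + d) * 0) * weight s))
      by (f_equal; ring).
    apply (is_lim_seq_scal_r (fun k => 2 * d + (2 + d) * (/ 2) ^ k) (weight s)
             (Finite (2 * d + (2 + d) * 0))).
    apply is_lim_seq_plus'; [apply is_lim_seq_const|].
    apply (is_lim_seq_scal_l (fun k => (/ 2) ^ k) (2 + d) (Finite 0)).
    apply is_lim_seq_geom. rewrite Rabs_pos_eq; lra.
Qed.

Lemma solution_diff_v (a1 a2 : R) (w1 v1 w2 v2 : R -> R) (s : R) :
  step a1 w1 w1 v1 -> step a2 w2 w2 v2 -> 0 <= s ->
  Rabs (v1 s - v2 s) <= 4 * Rabs (a1 - a2) * weight s * s.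
Proof.
  intros S1 S2 hs.
  replace (4 * Rabs (a1 - a2)) with (2 * (2 * Rabs (a1 - a2))) by ring.
  apply (step_v_diff a1 a2 w1 w2 w1 v1 w2 v2); trivial.
  - intros t ht. apply (solution_diff a1 a2 w1 v1 w2 v2); trivial. lra.
  - pose proof (Rabs_pos (a1 - a2)). lra.
Qed.

(** * Existence by Picard iteration *)

Lemma RInt_derive (k : R -> R) (s : R) :
  (forall t, continuity_pt k t) -> is_derive (fun s => RInt k 0 s) s (k s).
Proof.
  intros hk.
  apply (is_derive_RInt k (fun s => RInt k 0 s) 0 s).
  - apply filter_forall. intros y.
    apply (RInt_correct (V := R_CompleteNormedModule)),
      (ex_RInt_continuous (V := R_CompleteNormedModule)).
    intros z _. apply continuity_pt_filterlim, hk.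
  - apply continuity_pt_filterlim, hk.
Qed.

Lemma primitive_exists (k : R -> R) :
  (forall s, continuity_pt k s) ->
  exists F : R -> R, F 0 = 0 /\ forall s, is_derive F s (k s).
Proof.
  intros hk. exists (fun s => RInt k 0 s). split; [exact (RInt_point 0 k)|].
  intros s. now apply RInt_derive.
Qed.

Lemma continuity_pt_Rmax0 (s : R) : continuity_pt (fun t => Rmax 0 t) s.
Proof.
  apply continuity_pt_eps. intros e he. exists e. split; [exact he|]. intros y hy.
  eapply Rle_lt_trans; [|exact hy].
  unfold Rmax. destruct (Rle_dec 0 y); destruct (Rle_dec 0 s);
    unfold Rabs; repeat destruct Rcase_abs; lra.
Qed.

Lemma continuity_pt_ext_near (f h : R -> R) (x d : R) :
  0 < d -> (forall y, Rabs (y - x) < d -> h y = f y) ->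
  continuity_pt f x -> continuity_pt h x.
Proof.
  intros hd he hf. apply continuity_pt_eps. intros e hep.
  destruct (proj1 (continuity_pt_eps f x) hf e hep) as [d' [hd' H]].
  exists (Rmin d d'). split; [now apply Rmin_glb_lt|].
  intros y hy. pose proof (Rmin_l d d'). pose proof (Rmin_r d d').
  rewrite (he y), (he x); [apply H; lra|rewrite Rminus_diag, Rabs_R0; lra|lra].
Qed.

(** Removes the singularity from the equation for [w]: the quotient [v/s], completed at 0 by the
    derivative of [v], is continuous and therefore has a primitive. *)
Lemma difference_quotient_continuity (F k : R -> R) (s : R) :
  F 0 = 0 -> (forall s, is_derive F s (k s)) ->
  continuity_pt (fun t => if Req_EM_T t 0 then k 0 else F t / t) s.
Proof.
  intros F0 dF. destruct (Req_dec s 0) as [->|hs].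
  - apply continuity_pt_eps. intros e he.
    pose proof (proj1 (is_derive_Reals F 0 (k 0)) (dF 0)) as D.
    destruct (D e he) as [d H]. exists d. split; [apply cond_pos|].
    intros y hy. destruct (Req_EM_T 0 0) as [_|n]; [|lra].
    destruct (Req_EM_T y 0) as [->|ne].
    + now rewrite Rminus_diag, Rabs_R0.
    + rewrite Rminus_0_r in hy. specialize (H y ne hy).
      now rewrite Rplus_0_l, F0, Rminus_0_r in H.
  - apply (continuity_pt_ext_near (fun t => F t / t) _ s (Rabs s)).
    + now apply Rabs_pos_lt.
    + intros y hy. destruct (Req_EM_T y 0) as [->|ne]; trivial.
      rewrite Rminus_0_l, Rabs_Ropp in hy. lra.
    + cont. exact (is_derive_continuity_pt _ _ _ (dF s)).
Qed.

Lemma step_exists (a : R) (f : R -> R) :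
  (forall s, 0 <= s -> continuity_pt f s) -> exists w v, step a f w v.
Proof.
  (* [Rmax 0] freezes the data on the negative axis, so that the primitives are differentiable on
     both sides of 0. *)
  intros hf. set (h := fun s => g (f (Rmax 0 s)) / (1 + Rmax 0 s) ^ 2).
  assert (hp : forall s, 0 <= Rmax 0 s) by (intros s; apply Rmax_l).
  destruct (primitive_exists h) as [v [v0 dv]].
  { intros s. unfold h. cont.
    - apply (continuity_pt_fun_comp (fun s => f (Rmax 0 s)) g).
      + apply (continuity_pt_fun_comp (fun s => Rmax 0 s) f).
        * apply continuity_pt_Rmax0.
        * apply hf, hp.
      + apply g_continuity.
    - apply continuity_pt_Rmax0.
    - specialize (hp s). nra. }
  destruct (primitive_exists (fun s => (1 + s) * (if Req_EM_T s 0 then h 0 else v s / s)))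
    as [F [F0 dF]].
  { intros s. cont. now apply difference_quotient_continuity. }
  exists (fun s => a + F s), v. split; [|split; [|split; [|split; [|split]]]].
  - rewrite F0. ring.
  - exact v0.
  - intros s _. cont. exact (is_derive_continuity_pt _ _ _ (dF s)).
  - intros s _. exact (is_derive_continuity_pt _ _ _ (dv s)).
  - intros s hs. specialize (dv s). unfold h in dv. now rewrite Rmax_right in dv by lra.
  - intros s hs. specialize (dF s). destruct (Req_EM_T s 0) as [e|_]; [lra|].
    replace ((1 + s) / s * v s) with (0 + (1 + s) * (v s / s)) by (field; lra).
    apply is_derive_Rplus; [|exact dF]. apply @is_derive_const.
Qed.

(** Each iterate is picked by [epsilon] because [step_exists] is a mere existence statement; the
    choice is legitimate since every iterate is continuous on the half-line. *)
Fixpoint picard (a : R) (k : nat) : R -> R :=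
  match k with
  | O => fun _ => a
  | S k => epsilon (inhabits (fun _ => a)) (fun w => exists v, step a (picard a k) w v)
  end.

Lemma picard_continuity (a : R) (k : nat) (s : R) :
  0 <= s -> continuity_pt (picard a k) s.
Proof.
  revert s. induction k as [|k IH]; intros s hs.
  - apply continuity_pt_fun_const.
  - destruct (epsilon_spec (inhabits (fun _ => a))
                (fun w => exists v, step a (picard a k) w v) (step_exists a _ IH))
      as [v [_ [_ [cw _]]]].
    now apply cw.
Qed.

Lemma picard_step (a : R) (k : nat) : exists v, step a (picard a k) (picard a (S k)) v.
Proof.
  exact (epsilon_spec (inhabits (fun _ => a)) (fun w => exists v, step a (picard a k) w v)
           (step_exists a _ (picard_continuity a k))).
Qed.

Lemma picard_diff (a : R) (k : nat) (s : R) :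
  0 <= s -> Rabs (picard a (S k) s - picard a k s) <= (/ 2) ^ k * weight s.
Proof.
  revert s. induction k as [|k IH]; intros s hs.
  - destruct (picard_step a 0) as [v H1].
    pose proof (step_w_bound a _ _ v s H1 hs) as H. simpl (picard a 0 s). simpl (_ ^ 0). lra.
  - destruct (picard_step a (S k)) as [v H1]. destruct (picard_step a k) as [v' H2].
    assert (hk : 0 <= (/ 2) ^ k) by (apply pow_le; lra).
    pose proof (step_w_diff a a _ _ _ _ _ _ ((/ 2) ^ k) s H1 H2 hs) as H.
    rewrite Rminus_diag, Rabs_R0, Rplus_0_l in H. simpl (_ ^ (S k)).
    replace (/ 2 * (/ 2) ^ k) with ((/ 2) ^ k / 2) by field.
    apply H; trivial. intros t ht. apply IH. lra.
Qed.

(** A geometric sum of the bounds in [picard_diff]; the factor [1 - (/2)^l] is kept so that the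
    induction on [l] closes. *)
Lemma picard_diff_far (a : R) (k l : nat) (s : R) :
  0 <= s -> Rabs (picard a (k + l) s - picard a k s) <= 2 * (/ 2) ^ k * (1 - (/ 2) ^ l) * weight s.
Proof.
  intros hs. induction l as [|l IH].
  - rewrite Nat.add_0_r, Rminus_diag, Rabs_R0. simpl. lra.
  - replace (k + S l)%nat with (S (k + l)) by lia.
    replace (picard a (S (k + l)) s - picard a k s)
      with ((picard a (S (k + l)) s - picard a (k + l) s) + (picard a (k + l) s - picard a k s))
      by ring.
    eapply Rle_trans; [apply Rabs_triang|].
    pose proof (picard_diff a (k + l) s hs) as H. rewrite pow_add in H. simpl (_ ^ S l). lra.
Qed.

Lemma picard_limit (a s : R) : 0 <= s ->
  exists L, forall k, Rabs (L - picard a k s) <= 2 * (/ 2) ^ k * weight s.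
Proof.
  intros hs. pose proof (weight_ge s hs) as hw.
  assert (hk : forall k, 0 <= (/ 2) ^ k) by (intros k; apply pow_le; lra).
  assert (far : forall k n, (k <= n)%nat ->
            Rabs (picard a n s - picard a k s) <= 2 * (/ 2) ^ k * weight s).
  { intros k n hn. replace n with (k + (n - k))%nat by lia.
    eapply Rle_trans; [now apply picard_diff_far|].
    apply Rmult_le_compat_r; [nra|]. pose proof (hk k). pose proof (hk (n - k)%nat). nra. }
  assert (C : Cauchy_crit (fun k => picard a k s)).
  { intros e he.
    destruct (pow_lt_1_zero (/ 2) ltac:(rewrite Rabs_pos_eq; lra) (e / (4 * weight s)))
      as [N HN]; [apply Rdiv_lt_0_compat; nra|].
    exists N. intros n m hn hm. unfold Rdist.
    replace (picard a n s - picard a m s)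
      with ((picard a n s - picard a N s) - (picard a m s - picard a N s)) by ring.
    eapply Rle_lt_trans; [apply Rabs_triang|]. rewrite Rabs_Ropp.
    pose proof (far N n hn). pose proof (far N m hm).
    specialize (HN N (le_n N)). rewrite (Rabs_pos_eq _ (hk N)) in HN.
    apply (Rmult_lt_compat_r (4 * weight s)) in HN; [|nra].
    replace (e / (4 * weight s) * (4 * weight s)) with e in HN by (field; nra). nra. }
  destruct (Rcomplete.R_complete _ C) as [L HL]. exists L. intros k.
  apply is_lim_seq_Reals in HL.
  apply (is_lim_seq_le (fun n => Rabs (picard a (n + k) s - picard a k s))
           (fun _ => 2 * (/ 2) ^ k * weight s)
           (Rabs (L - picard a k s)) (2 * (/ 2) ^ k * weight s)).
  - intros n. apply far. lia.
  - apply (is_lim_seq_abs (fun n => picard a (n + k) s - picard a k s)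
             (Finite (L - picard a k s))).
    apply is_lim_seq_minus'; [|apply is_lim_seq_const].
    now apply (is_lim_seq_incr_n (fun n => picard a n s) k).
  - apply is_lim_seq_const.
Qed.

Lemma small_geometric (c e : R) : 0 < c -> 0 < e -> exists k, 2 * (/ 2) ^ k * c < e.
Proof.
  intros hc he.
  destruct (pow_lt_1_zero (/ 2) ltac:(rewrite Rabs_pos_eq; lra) (e / (2 * c))) as [N HN].
  { apply Rdiv_lt_0_compat; lra. }
  exists N. specialize (HN N (le_n N)).
  rewrite Rabs_pos_eq in HN by (apply pow_le; lra).
  apply (Rmult_lt_compat_r (2 * c)) in HN; [|lra].
  replace (e / (2 * c) * (2 * c)) with e in HN by (field; lra). lra.
Qed.

Lemma eq_of_geometric_bound (x y c : R) :
  0 < c -> (forall k, Rabs (x - y) <= 2 * (/ 2) ^ k * c) -> x = y.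
Proof.
  intros hc H. destruct (Req_dec x y) as [|hne]; trivial. exfalso.
  destruct (small_geometric c (Rabs (x - y)) hc) as [k hk].
  - apply Rabs_pos_lt. lra.
  - specialize (H k). lra.
Qed.

Lemma solution_exists (a : R) : exists p : (R -> R) * (R -> R), step a (fst p) (fst p) (snd p).
Proof.
  assert (hlim : forall s, exists L, forall k,
            Rabs (L - picard a k (Rmax 0 s)) <= 2 * (/ 2) ^ k * weight (Rmax 0 s)).
  { intros s. apply picard_limit, Rmax_l. }
  set (u := fun s => epsilon (inhabits 0) (fun L => forall k,
            Rabs (L - picard a k (Rmax 0 s)) <= 2 * (/ 2) ^ k * weight (Rmax 0 s))).
  assert (hu : forall s, 0 <= s -> forall k, Rabs (u s - picard a k s) <= 2 * (/ 2) ^ k * weight s).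
  { intros s hs k. pose proof (epsilon_spec (inhabits 0) _ (hlim s) k) as H.
    fold (u s) in H. now rewrite Rmax_right in H by lra. }
  assert (hum : forall s, u (Rmax 0 s) = u s).
  { intros s. unfold u. now rewrite (Rmax_right 0 (Rmax 0 s)) by apply Rmax_l. }
  assert (cu : forall s, 0 <= s -> continuity_pt u s).
  { intros s hs. apply continuity_pt_eps. intros e he.
    destruct (small_geometric (weight (s + 1)) (e / 3)) as [k hk].
    - pose proof (weight_ge (s + 1)). nra.
    - lra.
    - destruct (proj1 (continuity_pt_eps _ s) (picard_continuity a k s hs) (e / 3))
        as [d [hd Hd]]; [lra|].
      exists (Rmin d 1). split; [apply Rmin_glb_lt; lra|]. intros y hy.
      pose proof (Rmin_l d 1). pose proof (Rmin_r d 1).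
      assert (hm : Rabs (Rmax 0 y - s) <= Rabs (y - s)).
      { unfold Rmax. destruct Rle_dec; unfold Rabs; repeat destruct Rcase_abs; lra. }
      rewrite <- (hum y). set (z := Rmax 0 y) in *.
      assert (hz : 0 <= z <= s + 1).
      { split; [apply Rmax_l|]. destruct (proj1 (Rabs_le_between (z - s) 1)); lra. }
      assert (bd : forall t, 0 <= t <= s + 1 -> Rabs (u t - picard a k t) < e / 3).
      { intros t ht. eapply Rle_lt_trans; [apply hu; lra|].
        eapply Rle_lt_trans; [|exact hk].
        apply Rmult_le_compat_l; [|now apply weight_mono].
        assert (0 <= (/ 2) ^ k) by (apply pow_le; lra). lra. }
      pose proof (bd z hz) as b1. pose proof (bd s ltac:(lra)) as b2.
      specialize (Hd z ltac:(lra)).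
      apply Rabs_def2 in b1, b2, Hd. apply Rabs_def1; lra. }
  (* One more step from the limit [u] produces [w] together with its flux. Then [u = w], since both
     are within [(/2)^k weight] of [picard a (S k)]; no limit has to be taken under an integral. *)
  destruct (step_exists a u cu) as [w [v Hw]].
  assert (E : forall s, 0 <= s -> u s = w s).
  { intros s hs. pose proof (weight_ge s hs).
    apply (eq_of_geometric_bound _ _ (weight s)); [nra|]. intros k.
    destruct (picard_step a k) as [v' Hk].
    assert (hk : 0 <= (/ 2) ^ k) by (apply pow_le; lra).
    pose proof (step_w_diff a a _ _ _ _ _ _ (2 * (/ 2) ^ k) s Hw Hk hs) as H'.
    rewrite Rminus_diag, Rabs_R0, Rplus_0_l in H'.
    specialize (H' ltac:(intros t ht; apply hu; lra) ltac:(lra)).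
    pose proof (hu s hs (S k)) as H2. simpl (_ ^ (S k)) in H2.
    replace (u s - w s) with ((u s - picard a (S k) s) - (w s - picard a (S k) s))
      by ring.
    eapply Rle_trans; [apply Rabs_triang|]. rewrite Rabs_Ropp. lra. }
  exists (w, v). destruct Hw as [i [z [cw [cv [dv dw]]]]]. simpl.
  split; [exact i|split; [exact z|split; [exact cw|split; [exact cv|split; [|exact dw]]]]].
  intros s hs. rewrite <- E by lra. now apply dv.
Qed.

Definition profile (a : R) : R -> R :=
  fst (proj1_sig (constructive_indefinite_description _ (solution_exists a))).
Definition flux (a : R) : R -> R :=
  snd (proj1_sig (constructive_indefinite_description _ (solution_exists a))).

Lemma profile_solution (a : R) : step a (profile a) (profile a) (flux a).
Proof. exact (proj2_sig (constructive_indefinite_description _ (solution_exists a))). Qed.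

Lemma profile_start (a : R) : profile a 0 = a.
Proof. apply (profile_solution a). Qed.

Lemma flux_start (a : R) : flux a 0 = 0.
Proof. apply (profile_solution a). Qed.

Lemma profile_continuity (a s : R) : 0 <= s -> continuity_pt (profile a) s.
Proof. apply (profile_solution a). Qed.

Lemma flux_continuity (a s : R) : 0 <= s -> continuity_pt (flux a) s.
Proof. apply (profile_solution a). Qed.

Lemma profile_derive (a s : R) : 0 < s -> is_derive (profile a) s ((1 + s) / s * flux a s).
Proof. apply (profile_solution a). Qed.

Lemma flux_derive (a s : R) : 0 < s -> is_derive (flux a) s (g (profile a s) / (1 + s) ^ 2).
Proof. apply (profile_solution a). Qed.

(* Backward Gronwall: [exp (C t) ((w - c)^2 + v^2)] is nondecreasing on [[d, s]]. *)
Lemma equilibrium_rigid (a c s : R) :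
  0 < s -> g c = 0 -> profile a s = c -> flux a s = 0 -> a = c.
Proof.
  intros hs hc hw hv.
  assert (E : forall d, 0 < d <= s -> profile a d = c).
  { intros d hd. set (C := 2 + 2 * (1 + d) / d).
    set (e := fun t => (profile a t - c) ^ 2 + flux a t ^ 2).
    set (e' := fun t => 2 * (profile a t - c) * ((1 + t) / t * flux a t)
                        + 2 * flux a t * (g (profile a t) / (1 + t) ^ 2)).
    assert (H : exp (C * d) * e d <= exp (C * s) * e s).
    { apply (nondecreasing_of_derive (fun t => exp (C * t) * e t)
               (fun t => exp (C * t) * (C * e t + e' t))).
      - lra.
      - intros t ht. apply continuity_pt_fun_mult.
        + apply (is_derive_continuity_pt _ _ (C * exp (C * t))).
          auto_derive; trivial. ring.
        + unfold e. cont; [apply profile_continuity|apply flux_continuity]; lra.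
      - intros t ht. unfold e, e'.
        pose proof (profile_derive a t ltac:(lra)) as D1.
        pose proof (flux_derive a t ltac:(lra)) as D2.
        auto_derive.
        + repeat split; eexists; eassumption.
        + assert (E1 : Derive (fun x : R => profile a x) t = (1 + t) / t * flux a t)
            by exact (is_derive_unique _ _ _ D1).
          assert (E2 : Derive (fun x : R => flux a x) t = g (profile a t) / (1 + t) ^ 2)
            by exact (is_derive_unique _ _ _ D2).
          rewrite E1, E2. ring.
      - intros t ht. apply Rmult_le_pos; [left; apply exp_pos|].
        unfold e, e'. set (p := profile a t - c). set (q := flux a t).
        assert (hg : Rabs (g (profile a t)) <= 2 * Rabs p).
        { replace (g (profile a t)) with (g (profile a t) - g c) by (rewrite hc; ring).
          apply g_lipschitz. }
        assert (k1 : 0 < (1 + t) / t <= (1 + d) / d).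
        { split; [apply Rdiv_lt_0_compat; lra|].
          replace ((1 + t) / t) with (1 + / t) by (field; lra).
          replace ((1 + d) / d) with (1 + / d) by (field; lra).
          apply Rplus_le_compat_l, Rinv_le_contravar; lra. }
        assert (k2 : 0 < / (1 + t) ^ 2 <= 1).
        { split; [apply Rinv_0_lt_compat; nra|].
          rewrite <- Rinv_1. apply Rinv_le_contravar; nra. }
        assert (b1 : - ((1 + d) / d * (p ^ 2 + q ^ 2)) <= 2 * p * ((1 + t) / t * q)).
        { assert (- (p ^ 2 + q ^ 2) <= 2 * p * q).
          { pose proof (pow2_ge_0 (p + q)). lra. }
          assert (0 <= p ^ 2 + q ^ 2) by nra.
          revert k1. generalize ((1 + t) / t) ((1 + d) / d). intros k K k1.
          apply Rle_trans with (k * - (p ^ 2 + q ^ 2)); nra. }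
        assert (b2 : - (2 * (p ^ 2 + q ^ 2)) <= 2 * q * (g (profile a t) / (1 + t) ^ 2)).
        { unfold Rdiv. apply Rle_trans with (- (Rabs (2 * q * (g (profile a t) * / (1 + t) ^ 2)))).
          - apply Ropp_le_contravar. rewrite !Rabs_mult.
            rewrite (Rabs_pos_eq 2), (Rabs_pos_eq (/ _)) by lra.
            apply Rle_trans with (2 * Rabs q * (2 * Rabs p)).
            + apply Rmult_le_compat_l; [pose proof (Rabs_pos q); lra|].
              pose proof (Rabs_pos (g (profile a t))). nra.
            + rewrite <- (pow2_abs p), <- (pow2_abs q).
              pose proof (Rle_0_sqr (Rabs p - Rabs q)). unfold Rsqr in *. nra.
          - pose proof (Rcomplements.Rabs_maj2 (2 * q * (g (profile a t) * / (1 + t) ^ 2))). lra. }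
        unfold C. fold p q. assert (0 <= (1 + d) / d * (p ^ 2 + q ^ 2)).
        { apply Rmult_le_pos; nra. }
        replace (2 * (1 + d) / d) with (2 * ((1 + d) / d)) by (field; lra). lra. }
    replace (e s) with 0 in H by (unfold e; rewrite hw, hv; ring).
    rewrite Rmult_0_r in H. pose proof (exp_pos (C * d)).
    assert (he : e d <= 0) by nra. unfold e in he. nra. }
  (* The constant [C] blows up as [d] tends to 0, so the Gronwall argument cannot reach the starting
     point; continuity of the profile at 0 does. *)
  destruct (Req_dec a c) as [|hne]; trivial. exfalso.
  destruct (proj1 (continuity_pt_eps _ 0) (profile_continuity a 0 (Rle_refl 0)) (Rabs (a - c)))
    as [d [hd Hd]]; [apply Rabs_pos_lt; lra|].
  set (t := Rmin (d / 2) s).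
  assert (ht : 0 < t <= s) by (split; [apply Rmin_glb_lt; lra|apply Rmin_r]).
  pose proof (Rmin_l (d / 2) s). fold t in H.
  specialize (Hd t). rewrite (E t ht), profile_start, Rminus_0_r, Rabs_pos_eq in Hd by lra.
  rewrite (Rabs_minus_sym c a) in Hd. lra.
Qed.

(** * The Pruefer angle *)

Definition radius2 (a s : R) : R := profile a s ^ 2 + flux a s ^ 2.

(* The derivative of the Pruefer angle of [(w, -v)]. *)
Definition angular_speed (a s : R) : R :=
  ((1 + s) / s * flux a s ^ 2 - profile a s * (g (profile a s) / (1 + s) ^ 2)) / radius2 a s.

(** An integral of the expected speed rather than an arctangent, so that no branch has to be
    followed. That it is the angle of [(w, -v)] is the content of [polar_form]. *)
Definition phase (a s : R) : R := RInt (fun t => angular_speed a (Rmax 0 t)) 0 s.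

(** A solution reaching the origin would be at the equilibrium 0, so rigidity would force
    [a = 0]. *)
Lemma radius2_pos (a s : R) : 0 < a -> 0 <= s -> 0 < radius2 a s.
Proof.
  intros ha hs. unfold radius2.
  assert (h : 0 <= profile a s ^ 2 + flux a s ^ 2) by nra.
  destruct h as [h|h]; [exact h|exfalso].
  assert (hp : profile a s = 0) by nra. assert (hf : flux a s = 0) by nra.
  destruct hs as [hs|<-].
  - assert (g0 : g 0 = 0) by (rewrite g_inside; lra).
    pose proof (equilibrium_rigid a 0 s hs g0 hp hf). lra.
  - rewrite profile_start in hp. lra.
Qed.

Lemma radius2_continuity (a s : R) : 0 <= s -> continuity_pt (radius2 a) s.
Proof.
  intros hs. unfold radius2. cont; [now apply profile_continuity|now apply flux_continuity].
Qed.

Lemma flux_bound (a s : R) : 0 <= s -> Rabs (flux a s) <= s.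
Proof. apply (step_v_bound a _ _ _ s (profile_solution a)). Qed.

Lemma angular_speed_continuity (a s : R) :
  0 < a -> continuity_pt (fun t => angular_speed a (Rmax 0 t)) s.
Proof.
  intros ha.
  (* The critical point is 0, where [|v| <= s] bounds this term by [(1+s) s]. At 0 itself the
     totalized quotient is multiplied by [0^2], so its value agrees with the limit. *)
  assert (K : continuity_pt (fun t => (1 + Rmax 0 t) / Rmax 0 t * flux a (Rmax 0 t) ^ 2) s).
  { destruct (Rtotal_order s 0) as [h|[->|h]].
    - apply (continuity_pt_ext_near (fun _ => (1 + 0) / 0 * flux a 0 ^ 2) _ s (- s)); [lra| |].
      + intros y hy. apply Rabs_def2 in hy. rewrite Rmax_left by lra. reflexivity.
      + apply continuity_pt_fun_const.
    - apply continuity_pt_eps. intros e he.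
      exists (Rmin 1 (e / 2)). split; [apply Rmin_glb_lt; lra|]. intros y hy.
      pose proof (Rmin_l 1 (e / 2)). pose proof (Rmin_r 1 (e / 2)).
      rewrite (Rmax_left 0 0), flux_start by lra.
      replace ((1 + 0) / 0 * 0 ^ 2) with 0 by ring. rewrite Rminus_0_r in hy |- *.
      destruct (Rle_lt_dec y 0).
      + rewrite Rmax_left, flux_start by lra.
        replace ((1 + 0) / 0 * 0 ^ 2) with 0 by ring. now rewrite Rabs_R0.
      + rewrite Rmax_right by lra. rewrite Rabs_pos_eq in hy by lra.
        pose proof (flux_bound a y ltac:(lra)) as hb.
        rewrite <- (pow2_abs (flux a y)). set (f := Rabs (flux a y)) in *.
        assert (0 <= f) by apply Rabs_pos.
        assert (0 <= (1 + y) / y) by (apply Rlt_le, Rdiv_lt_0_compat; lra).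
        rewrite Rabs_pos_eq by (apply Rmult_le_pos; nra).
        apply Rle_lt_trans with ((1 + y) / y * y ^ 2).
        * apply Rmult_le_compat_l; nra.
        * replace ((1 + y) / y * y ^ 2) with ((1 + y) * y) by (field; lra). nra.
    - apply (continuity_pt_fun_comp (fun t => Rmax 0 t) (fun t => (1 + t) / t * flux a t ^ 2)).
      + apply continuity_pt_Rmax0.
      + rewrite Rmax_right by lra. cont; [lra|apply flux_continuity; lra]. }
  assert (hp : 0 <= Rmax 0 s) by apply Rmax_l.
  assert (cp : continuity_pt (fun t => profile a (Rmax 0 t)) s).
  { apply (continuity_pt_fun_comp (fun t => Rmax 0 t) (profile a)).
    - apply continuity_pt_Rmax0.
    - now apply profile_continuity. }
  unfold angular_speed. apply continuity_pt_fun_mult; [apply continuity_pt_fun_minus|].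
  - exact K.
  - cont.
    + apply (continuity_pt_fun_comp (fun t => profile a (Rmax 0 t)) g); [exact cp|].
      apply g_continuity.
    + apply continuity_pt_Rmax0.
    + nra.
  - apply continuity_pt_inv_fun.
    + apply (continuity_pt_fun_comp (fun t => Rmax 0 t) (radius2 a)).
      * apply continuity_pt_Rmax0.
      * now apply radius2_continuity.
    + pose proof (radius2_pos a _ ha hp). lra.
Qed.

Lemma phase_start (a : R) : phase a 0 = 0.
Proof. exact (RInt_point 0 (fun t => angular_speed a (Rmax 0 t))). Qed.

Lemma phase_derive_max (a s : R) :
  0 < a -> is_derive (phase a) s (angular_speed a (Rmax 0 s)).
Proof.
  intros ha. apply (RInt_derive (fun t => angular_speed a (Rmax 0 t))).
  intros t. now apply angular_speed_continuity.
Qed.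

Lemma phase_derive (a s : R) : 0 < a -> 0 < s -> is_derive (phase a) s (angular_speed a s).
Proof.
  intros ha hs. pose proof (phase_derive_max a s ha) as H. now rewrite Rmax_right in H by lra.
Qed.

Lemma phase_continuity (a s : R) : 0 < a -> continuity_pt (phase a) s.
Proof. intros ha. exact (is_derive_continuity_pt _ _ _ (phase_derive_max a s ha)). Qed.

Lemma angular_speed_nonneg (a s : R) : 0 < a -> 0 < s -> 0 <= angular_speed a s.
Proof.
  intros ha hs. unfold angular_speed. pose proof (radius2_pos a s ha ltac:(lra)) as hr.
  apply Rmult_le_pos; [|left; now apply Rinv_0_lt_compat].
  assert (h1 : 0 < (1 + s) / s) by (apply Rdiv_lt_0_compat; lra).
  assert (h2 : 0 < / (1 + s) ^ 2) by (apply Rinv_0_lt_compat; nra).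
  pose proof (g_sign (profile a s)) as hg.
  replace (profile a s * (g (profile a s) / (1 + s) ^ 2))
    with (profile a s * g (profile a s) * / (1 + s) ^ 2) by (field; lra).
  nra.
Qed.

Lemma angular_speed_pos (a s : R) :
  0 < a -> 0 < s -> Rabs (profile a s) < 1 -> 0 < angular_speed a s.
Proof.
  intros ha hs hw. unfold angular_speed. pose proof (radius2_pos a s ha ltac:(lra)) as hr.
  apply Rmult_lt_0_compat; [|now apply Rinv_0_lt_compat].
  assert (h1 : 0 < (1 + s) / s) by (apply Rdiv_lt_0_compat; lra).
  assert (h2 : 0 < / (1 + s) ^ 2) by (apply Rinv_0_lt_compat; nra).
  apply Rabs_def2 in hw. rewrite g_inside by lra. unfold radius2 in hr.
  set (w := profile a s) in *. set (v := flux a s) in *.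
  replace (w * ((w ^ 3 - w) / (1 + s) ^ 2)) with (- (w ^ 2 * (1 - w ^ 2) * / (1 + s) ^ 2))
    by (field; lra).
  assert (hw2 : 0 < 1 - w ^ 2) by nra.
  destruct (Req_dec w 0) as [e|ne].
  - rewrite e in hr |- *. assert (0 < v ^ 2) by lra. nra.
  - assert (0 < w ^ 2) by nra.
    assert (0 < w ^ 2 * (1 - w ^ 2)) by nra.
    assert (0 < w ^ 2 * (1 - w ^ 2) * / (1 + s) ^ 2) by (apply Rmult_lt_0_compat; lra).
    nra.
Qed.

Lemma phase_mono (a s t : R) : 0 < a -> 0 <= s <= t -> phase a s <= phase a t.
Proof.
  intros ha hst. apply (nondecreasing_of_derive _ (angular_speed a)); [lra| | |].
  - intros u hu. now apply phase_continuity.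
  - intros u hu. apply phase_derive; lra.
  - intros u hu. apply angular_speed_nonneg; lra.
Qed.

Lemma phase_increasing (a s t : R) :
  0 < a -> 0 <= s < t -> (forall u, 0 <= u < t -> Rabs (profile a u) < 1) ->
  phase a s < phase a t.
Proof.
  intros ha hst hb. apply (increasing_of_derive _ (angular_speed a)); [lra| | |].
  - intros u hu. now apply phase_continuity.
  - intros u hu. apply phase_derive; lra.
  - intros u hu. apply angular_speed_pos; [lra|lra|apply hb; lra].
Qed.

Lemma phase_nonneg (a s : R) : 0 < a -> 0 <= s -> 0 <= phase a s.
Proof. intros ha hs. rewrite <- (phase_start a). apply phase_mono; lra. Qed.

(** If [theta] is the true angle of [(w, -v)], then [q^2 / radius2] is [sin^2 (phase - theta)]. It
    starts at 0, and its derivative vanishes because [angular_speed] is the derivative of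
    [theta]. *)
Lemma polar_angle (a s : R) : 0 < a -> 0 <= s ->
  profile a s * sin (phase a s) + flux a s * cos (phase a s) = 0.
Proof.
  intros ha hs.
  set (q := fun t => profile a t * sin (phase a t) + flux a t * cos (phase a t)).
  set (h := fun t => q t ^ 2 / radius2 a t).
  assert (cq : forall t, 0 <= t -> continuity_pt q t).
  { intros t ht. unfold q. cont.
    - now apply profile_continuity.
    - apply (continuity_pt_fun_comp (phase a) sin); [now apply phase_continuity|].
      apply continuity_sin.
    - now apply flux_continuity.
    - apply (continuity_pt_fun_comp (phase a) cos); [now apply phase_continuity|].
      apply continuity_cos. }
  assert (E : h s = h 0).
  { destruct hs as [hs|<-]; [|reflexivity].
    destruct (mean_value_open h (fun _ => 0) 0 s hs) as [c [_ E]].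
    - intros t ht. unfold h. cont.
      + apply cq. lra.
      + apply radius2_continuity. lra.
      + pose proof (radius2_pos a t ha ltac:(lra)). lra.
    - intros t ht. pose proof (radius2_pos a t ha ltac:(lra)) as hr.
      pose proof (profile_derive a t ltac:(lra)) as D1.
      pose proof (flux_derive a t ltac:(lra)) as D2.
      pose proof (phase_derive a t ha ltac:(lra)) as D3.
      unfold h, q, radius2. auto_derive.
      + repeat split; try (eexists; eassumption). unfold radius2 in hr. simpl in hr. lra.
      + assert (E1 : Derive (fun x : R => profile a x) t = (1 + t) / t * flux a t)
          by exact (is_derive_unique _ _ _ D1).
        assert (E2 : Derive (fun x : R => flux a x) t = g (profile a t) / (1 + t) ^ 2)
          by exact (is_derive_unique _ _ _ D2).
        assert (E3 : Derive (fun x : R => phase a x) t = angular_speed a t)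
          by exact (is_derive_unique _ _ _ D3).
        rewrite E1, E2, E3. unfold angular_speed. unfold radius2 in hr |- *.
        field. repeat split; lra.
    - lra. }
  unfold h in E. replace (q 0) with 0 in E.
  - fold (q s). pose proof (radius2_pos a s ha hs) as hr.
    replace (0 ^ 2 / radius2 a 0) with 0 in E by (unfold Rdiv; ring).
    apply (Rmult_eq_compat_r (radius2 a s)) in E.
    replace (q s ^ 2 / radius2 a s * radius2 a s) with (q s ^ 2) in E by (field; lra). nra.
  - unfold q. rewrite flux_start, phase_start, sin_0. ring.
Qed.

(** By [polar_angle] the vector [(w, -v)] lies on the line of direction [phase]. Its signed length
    [p] never vanishes and equals [a > 0] at the start, so it stays positive. *)
Lemma polar_form (a s : R) : 0 < a -> 0 <= s ->
  exists rho, 0 < rho /\ profile a s = rho * cos (phase a s) /\ flux a s = - rho * sin (phase a s).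
Proof.
  intros ha hs.
  set (p := fun t => profile a t * cos (phase a t) - flux a t * sin (phase a t)).
  assert (hw : forall t, 0 <= t -> profile a t = p t * cos (phase a t)
                           /\ flux a t = - p t * sin (phase a t)).
  { intros t ht. pose proof (polar_angle a t ha ht) as Q.
    pose proof (sin2_cos2 (phase a t)) as T. unfold Rsqr in T. unfold p.
    set (c := cos (phase a t)) in *. set (d := sin (phase a t)) in *.
    set (w := profile a t) in *. set (v := flux a t) in *.
    split.
    - transitivity (w * (d * d + c * c) - (w * d + v * c) * d); [rewrite T, Q|]; ring.
    - transitivity (v * (d * d + c * c) - (w * d + v * c) * c); [rewrite T, Q|]; ring. }
  exists (p s). split; [|now apply hw].
  assert (hne : forall t, 0 <= t -> p t <> 0).
  { intros t ht e. destruct (hw t ht) as [h1 h2]. rewrite e in h1, h2.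
    pose proof (radius2_pos a t ha ht) as hr. unfold radius2 in hr. rewrite h1, h2 in hr. lra. }
  assert (p0 : p 0 = a) by (unfold p; rewrite profile_start, flux_start, phase_start, cos_0; ring).
  destruct (Rle_lt_dec (p s) 0) as [hle|]; [exfalso|assumption].
  destruct (intermediate_value (fun t => - p t) 0 s 0) as [z [hz e]]; trivial.
  - intros t ht. unfold p. cont.
    + apply profile_continuity; lra.
    + apply (continuity_pt_fun_comp (phase a) cos); [now apply phase_continuity|].
      apply continuity_cos.
    + apply flux_continuity; lra.
    + apply (continuity_pt_fun_comp (phase a) sin); [now apply phase_continuity|].
      apply continuity_sin.
  - rewrite p0. lra.
  - apply (hne z); lra.
Qed.

(** The dot and cross products of two nearby solutions control the cosine and sine of the difference
    of their angles, hence the difference only modulo [2 pi]. The inequality [est] says that the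
    difference never equals [e'] or [-e']; being continuous and 0 at the start, it stays between
    them. *)
Lemma phase_continuous_dependence (a X e : R) :
  0 < a -> 0 <= X -> 0 < e ->
  exists d, 0 < d /\ forall b, 0 < b -> Rabs (b - a) < d -> Rabs (phase b X - phase a X) < e.
Proof.
  intros ha hX he0.
  set (e' := Rmin e 1).
  assert (he : 0 < e' <= 1) by (split; [apply Rmin_glb_lt; lra|apply Rmin_r]).
  destruct (continuity_ab_min (radius2 a) 0 X hX) as [tm [Hm htm]].
  { intros t ht. apply radius2_continuity. lra. }
  set (mu := radius2 a tm) in *.
  assert (hmu : 0 < mu) by (apply radius2_pos; lra).
  assert (hs : 0 < sin e') by (apply sin_gt_0; pose proof PI2_1; unfold PI2 in *; lra).
  assert (hc : 0 < cos e') by (apply cos_gt_0; pose proof PI2_1; unfold PI2 in *; lra).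
  pose proof (weight_ge X hX) as hw.
  (* [N] is a Lipschitz constant in the initial value for profile and flux on [0,X], [M/2] exceeds
     [|profile a| + |flux a|] there, and [d] is chosen so that [M N d = mu sin e' / 2], where [mu]
     is the least squared radius. *)
  set (N := 4 * weight X * (1 + X)).
  assert (hN : 0 < N) by (unfold N; nra).
  set (M := 2 * (a + weight X + X + 1)).
  assert (hM : 0 < M) by (unfold M; nra).
  set (d := mu * sin e' / (2 * M * N)).
  assert (hd : 0 < d) by (unfold d; apply Rdiv_lt_0_compat; nra).
  exists d. split; [exact hd|]. intros b hb hab.
  assert (est : forall t, 0 <= t <= X ->
     Rabs (sin (phase b t - phase a t)) * cos e' < sin e' * cos (phase b t - phase a t)).
  { intros t ht.
    pose proof (solution_diff b a _ _ _ _ t (profile_solution b) (profile_solution a)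
                  ltac:(lra)) as k1.
    pose proof (solution_diff_v b a _ _ _ _ t (profile_solution b) (profile_solution a)
                  ltac:(lra)) as k2.
    pose proof (step_w_bound a _ _ _ t (profile_solution a) ltac:(lra)) as k3.
    pose proof (flux_bound a t ltac:(lra)) as k4.
    pose proof (weight_mono t X ht) as k5. pose proof (weight_ge t ltac:(lra)) as k6.
    assert (k7 : Rabs (profile a t) <= a + weight X).
    { replace (profile a t) with ((profile a t - a) + a) by ring.
      eapply Rle_trans; [apply Rabs_triang|]. rewrite (Rabs_pos_eq a); lra. }
    set (D := Rabs (b - a)) in *. assert (hD : 0 <= D) by apply Rabs_pos.
    assert (hDW : 0 <= D * weight X) by (apply Rmult_le_pos; nra).
    assert (hDWX : 0 <= D * weight X * X) by now apply Rmult_le_pos.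
    assert (k8 : Rabs (profile b t - profile a t) <= N * D).
    { unfold N. eapply Rle_trans; [exact k1|].
      apply Rle_trans with (2 * D * weight X); [apply Rmult_le_compat_l; lra|]. nra. }
    assert (k9 : Rabs (flux b t - flux a t) <= N * D).
    { unfold N. eapply Rle_trans; [exact k2|].
      apply Rle_trans with (4 * D * weight X * X); [|nra].
      apply Rmult_le_compat; try lra; [nra|]. apply Rmult_le_compat_l; lra. }
    pose proof (Hm t ht) as hmu'. unfold radius2 in hmu'.
    destruct (polar_form a t ha ltac:(lra)) as [ra [hra [wa va]]].
    destruct (polar_form b t hb ltac:(lra)) as [rb [hrb [wb vb]]].
    assert (dot : profile a t * profile b t + flux a t * flux b t
                  = ra * rb * cos (phase b t - phase a t)).
    { rewrite wa, va, wb, vb, cos_minus. ring. }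
    assert (cross : flux a t * profile b t - profile a t * flux b t
                    = ra * rb * sin (phase b t - phase a t)).
    { rewrite wa, va, wb, vb, sin_minus. ring. }
    assert (small : M * N * D < mu * sin e' / 2).
    { unfold d in hab. apply (Rmult_lt_compat_r (M * N)) in hab; [|nra].
      replace (mu * sin e' / (2 * M * N) * (M * N)) with (mu * sin e' / 2) in hab
        by (field; lra). lra. }
    set (d1 := profile b t - profile a t) in *. set (d2 := flux b t - flux a t) in *.
    assert (dotb : mu - M * N * D / 2 <= profile a t * profile b t + flux a t * flux b t).
    { replace (profile a t * profile b t + flux a t * flux b t)
        with ((profile a t ^ 2 + flux a t ^ 2) + (profile a t * d1 + flux a t * d2))
        by (unfold d1, d2; ring).
      assert (Rabs (profile a t * d1 + flux a t * d2) <= M * N * D / 2).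
      { eapply Rle_trans; [apply Rabs_triang|]. rewrite !Rabs_mult.
        apply Rle_trans with ((a + weight X) * (N * D) + X * (N * D)).
        - apply Rplus_le_compat; apply Rmult_le_compat; try apply Rabs_pos; lra.
        - unfold M. assert (0 <= N * D) by nra. nra. }
      pose proof (Rcomplements.Rabs_maj2 (profile a t * d1 + flux a t * d2)). lra. }
    assert (crossb : Rabs (flux a t * profile b t - profile a t * flux b t) <= M * N * D / 2).
    { replace (flux a t * profile b t - profile a t * flux b t)
        with (flux a t * d1 + - profile a t * d2) by (unfold d1, d2; ring).
      eapply Rle_trans; [apply Rabs_triang|]. rewrite !Rabs_mult, Rabs_Ropp.
      apply Rle_trans with (X * (N * D) + (a + weight X) * (N * D)).
      - apply Rplus_le_compat; apply Rmult_le_compat; try apply Rabs_pos; lra.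
      - unfold M. assert (0 <= N * D) by nra. nra. }
    rewrite dot in dotb. rewrite cross in crossb.
    assert (hrr : 0 < ra * rb) by now apply Rmult_lt_0_compat.
    rewrite Rabs_mult, (Rabs_pos_eq (ra * rb)) in crossb by lra.
    apply (Rmult_lt_reg_l (ra * rb)); [exact hrr|].
    pose proof (COS_bound e') as cb. pose proof (SIN_bound e') as sb.
    apply Rle_lt_trans with (M * N * D / 2).
    - set (q := Rabs (sin (phase b t - phase a t))) in *.
      assert (0 <= q) by apply Rabs_pos.
      apply Rle_trans with (ra * rb * q); [|exact crossb].
      apply Rmult_le_compat_l; nra.
    - apply Rlt_le_trans with (sin e' * (mu - M * N * D / 2)).
      + assert (0 <= M * N * D) by (apply Rmult_le_pos; nra). nra.
      + nra. }
  assert (B : Rabs (phase b X - phase a X) < e').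
  { destruct (Rle_lt_dec e' (Rabs (phase b X - phase a X))) as [hge|]; [exfalso|assumption].
    destruct (intermediate_value (fun t => Rabs (phase b t - phase a t)) 0 X e') as [z [hz ez]].
    - lra.
    - intros t ht. apply (continuity_pt_fun_comp (fun t => phase b t - phase a t) Rabs).
      + cont; now apply phase_continuity.
      + apply Rcontinuity_abs.
    - rewrite !phase_start, Rminus_diag, Rabs_R0. lra.
    - specialize (est z hz).
      assert (E : Rabs (sin (phase b z - phase a z)) = sin e'
                  /\ cos (phase b z - phase a z) = cos e').
      { revert ez. unfold Rabs at 1. destruct Rcase_abs as [hn|hp]; intros ez.
        - replace (phase b z - phase a z) with (- e') by lra.
          rewrite sin_neg, cos_neg, Rabs_Ropp, Rabs_pos_eq; lra.
        - rewrite ez, Rabs_pos_eq; lra. }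
      destruct E as [E1 E2]. rewrite E1, E2 in est. lra. }
  pose proof (Rmin_l e 1). fold e' in H. lra.
Qed.

(** * Zeros before leaving the strip *)

(* The profile completes its [k]-th zero before leaving [(-1,1)]. *)
Definition turns (k : nat) (a : R) : Prop :=
  exists X, 0 <= X /\ (forall s, 0 <= s <= X -> Rabs (profile a s) < 1) /\
            INR k * PI - PI / 2 < phase a X.

Lemma sin_add_INR_PI (j : nat) (x : R) : sin (x + INR j * PI) = (-1) ^ j * sin x.
Proof.
  induction j as [|j IH].
  - simpl. rewrite Rmult_0_l, Rplus_0_r. ring.
  - rewrite S_INR. replace (x + (INR j + 1) * PI) with ((x + INR j * PI) + PI) by ring.
    rewrite neg_sin, IH. simpl. ring.
Qed.

Lemma cos_add_INR_PI (j : nat) (x : R) : cos (x + INR j * PI) = (-1) ^ j * cos x.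
Proof.
  induction j as [|j IH].
  - simpl. rewrite Rmult_0_l, Rplus_0_r. ring.
  - rewrite S_INR. replace (x + (INR j + 1) * PI) with ((x + INR j * PI) + PI) by ring.
    rewrite neg_cos, IH. simpl. ring.
Qed.

Lemma sign_square (j : nat) : (-1) ^ j * (-1) ^ j = 1.
Proof. rewrite <- Rpow_mult_distr. replace (-1 * -1) with 1 by ring. apply pow1. Qed.

Lemma cos_half_odd (k : nat) : cos (INR k * PI - PI / 2) = 0.
Proof.
  replace (INR k * PI - PI / 2) with (- (PI / 2) + INR k * PI) by ring.
  rewrite cos_add_INR_PI, cos_neg, cos_PI2. ring.
Qed.

Lemma turns_le (j k : nat) (a : R) : (j <= k)%nat -> turns k a -> turns j a.
Proof.
  intros hjk [X [hX [hb hp]]]. exists X. split; [exact hX|split; [exact hb|]].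
  apply le_INR in hjk. pose proof PI_RGT_0. nra.
Qed.

Lemma profile_near (a X e : R) : 0 <= X -> 0 < e ->
  exists d, 0 < d /\ forall b, Rabs (b - a) < d -> forall s, 0 <= s <= X ->
    Rabs (profile b s - profile a s) < e /\ Rabs (flux b s - flux a s) < e.
Proof.
  intros hX he. pose proof (weight_ge X hX) as hw.
  set (N := 4 * weight X * (1 + X)).
  assert (hN : 0 < N) by (unfold N; nra).
  exists (e / N). split; [now apply Rdiv_lt_0_compat|].
  intros b hb s hs.
  pose proof (solution_diff b a _ _ _ _ s (profile_solution b) (profile_solution a)
                ltac:(lra)) as k1.
  pose proof (solution_diff_v b a _ _ _ _ s (profile_solution b) (profile_solution a)
                ltac:(lra)) as k2.
  pose proof (weight_mono s X hs) as k5. pose proof (weight_ge s ltac:(lra)) as k6.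
  set (D := Rabs (b - a)) in *. assert (hD : 0 <= D) by apply Rabs_pos.
  apply (Rmult_lt_compat_r N) in hb; [|exact hN].
  replace (e / N * N) with e in hb by (field; lra).
  assert (hDW : 0 <= D * weight X) by (apply Rmult_le_pos; nra).
  assert (hDWX : 0 <= D * weight X * X) by now apply Rmult_le_pos.
  assert (hDW' : D * weight s <= D * weight X) by (apply Rmult_le_compat_l; lra).
  unfold N in hb. split.
  - nra.
  - assert (D * weight s * s <= D * weight X * X) by (apply Rmult_le_compat; nra). nra.
Qed.

(** Both requirements are strict inequalities, one on a compact interval and one at its end. *)
Lemma turns_open (k : nat) (a : R) : 0 < a -> turns k a ->
  exists d, 0 < d /\ forall b, 0 < b -> Rabs (b - a) < d -> turns k b.
Proof.
  intros ha [X [hX [hb hp]]].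
  destruct (continuity_ab_maj (fun s => Rabs (profile a s)) 0 X hX) as [sm [Hm hsm]].
  { intros s hs. apply (continuity_pt_fun_comp (profile a) Rabs).
    - apply profile_continuity. lra.
    - apply Rcontinuity_abs. }
  pose proof (hb sm hsm) as hm.
  destruct (profile_near a X (1 - Rabs (profile a sm)) hX) as [d1 [hd1 H1]]; [lra|].
  destruct (phase_continuous_dependence a X (phase a X - (INR k * PI - PI / 2)) ha hX)
    as [d2 [hd2 H2]]; [lra|].
  exists (Rmin d1 d2). split; [now apply Rmin_glb_lt|]. intros b hb0 hba.
  pose proof (Rmin_l d1 d2). pose proof (Rmin_r d1 d2).
  exists X. split; [exact hX|split].
  - intros s hs. destruct (H1 b ltac:(lra) s hs) as [H3 _]. specialize (Hm s hs). simpl in Hm.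
    replace (profile b s) with ((profile b s - profile a s) + profile a s) by ring.
    eapply Rle_lt_trans; [apply Rabs_triang|]. lra.
  - specialize (H2 b hb0 ltac:(lra)). apply Rabs_def2 in H2. lra.
Qed.

Lemma first_exit (a : R) : 0 < a < 1 -> ~ (forall s, 0 <= s -> Rabs (profile a s) < 1) ->
  exists X, 0 < X /\ (forall s, 0 <= s < X -> Rabs (profile a s) < 1) /\
            Rabs (profile a X) = 1.
Proof.
  intros ha hn.
  assert (hbad : exists x, 0 <= x /\ 1 <= Rabs (profile a x)).
  { apply not_all_ex_not in hn. destruct hn as [x hx]. exists x.
    apply imply_to_and in hx. lra. }
  destruct hbad as [x [hx hbx]].
  set (E := fun y => 0 <= y /\ forall s, 0 <= s <= y -> Rabs (profile a s) < 1).
  assert (h0 : E 0).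
  { split; [lra|]. intros s hs. replace s with 0 by lra.
    rewrite profile_start, Rabs_pos_eq; lra. }
  destruct (completeness E) as [X [hub hlub]].
  { exists x. intros y [hy hE]. destruct (Rle_lt_dec y x) as [|hlt]; [assumption|].
    specialize (hE x ltac:(lra)). lra. }
  { now exists 0. }
  assert (hX0 : 0 <= X) by now apply hub.
  assert (hbelow : forall s, 0 <= s < X -> Rabs (profile a s) < 1).
  { intros s hs. destruct (Rlt_le_dec (Rabs (profile a s)) 1) as [|hge]; [assumption|].
    assert (X <= s); [|lra]. apply hlub. intros y [hy hE].
    destruct (Rle_lt_dec y s) as [|hlt]; [assumption|].
    specialize (hE s ltac:(lra)). lra. }
  pose proof (continuity_pt_fun_comp (profile a) Rabs X (profile_continuity a X hX0)
                (Rcontinuity_abs _)) as C.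
  assert (hge : 1 <= Rabs (profile a X)).
  { destruct (Rle_lt_dec 1 (Rabs (profile a X))) as [|hlt]; [assumption|exfalso].
    destruct (proj1 (continuity_pt_eps _ X) C (1 - Rabs (profile a X))) as [d [hd Hd]]; [lra|].
    assert (E (X + d / 2)) as hE.
    { split; [lra|]. intros s hs. destruct (Rlt_le_dec s X) as [|hle]; [apply hbelow; lra|].
      specialize (Hd s). assert (Rabs (s - X) < d) as hs' by (rewrite Rabs_pos_eq; lra).
      specialize (Hd hs'). apply Rabs_def2 in Hd. lra. }
    specialize (hub _ hE). lra. }
  assert (hXp : 0 < X).
  { destruct hX0 as [|<-]; [assumption|exfalso].
    rewrite profile_start, Rabs_pos_eq in hge; lra. }
  exists X. split; [exact hXp|split; [exact hbelow|]].
  destruct hge as [hgt|]; [exfalso|congruence].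
  destruct (proj1 (continuity_pt_eps _ X) C (Rabs (profile a X) - 1)) as [d [hd Hd]]; [lra|].
  set (s := Rmax (X - d / 2) 0).
  assert (hs : 0 <= s < X) by (unfold s; split; [apply Rmax_r|apply Rmax_lub_lt; lra]).
  pose proof (Rmax_l (X - d / 2) 0). fold s in H.
  specialize (Hd s ltac:(rewrite Rabs_minus_sym, Rabs_pos_eq; lra)).
  apply Rabs_def2 in Hd. specialize (hbelow s hs). lra.
Qed.

(** The profile leaves the strip transversally, and at that moment the angle is strictly below the
    level of the [k]-th zero. Shortly afterwards it is strictly outside with the angle still below
    the level. Nearby solutions share both properties, so they have left the strip without reaching
    the level. *)
Lemma not_turns_open_of_exit (k : nat) (a : R) :
  0 < a < 1 -> ~ (forall s, 0 <= s -> Rabs (profile a s) < 1) -> ~ turns k a ->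
  exists d, 0 < d /\ forall b, 0 < b -> Rabs (b - a) < d -> ~ turns k b.
Proof.
  intros ha hn ht. destruct (first_exit a ha hn) as [X [hX [hbelow hone]]].
  set (c := INR k * PI - PI / 2) in *.
  assert (hle : forall s, 0 <= s < X -> phase a s <= c).
  { intros s hs. destruct (Rle_lt_dec (phase a s) c) as [|hlt]; [assumption|exfalso].
    apply ht. exists s. split; [lra|split; [|exact hlt]]. intros t ht'. apply hbelow. lra. }
  pose proof (phase_continuity a X ltac:(lra)) as cph.
  (* At the level itself the profile would vanish, whereas its modulus is 1 at [X]. *)
  assert (hXc : phase a X < c).
  { destruct (Rtotal_order (phase a X) c) as [|[e|hgt]]; [assumption|exfalso|exfalso].
    - destruct (polar_form a X ltac:(lra) ltac:(lra)) as [rho [_ [hw _]]].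
      rewrite e in hw. unfold c in hw. rewrite cos_half_odd, Rmult_0_r in hw.
      rewrite hw, Rabs_R0 in hone. lra.
    - destruct (proj1 (continuity_pt_eps _ X) cph (phase a X - c)) as [d [hd Hd]]; [lra|].
      set (s := Rmax (X - d / 2) 0).
      assert (hs : 0 <= s < X) by (unfold s; split; [apply Rmax_r|apply Rmax_lub_lt; lra]).
      pose proof (Rmax_l (X - d / 2) 0). fold s in H.
      specialize (Hd s ltac:(rewrite Rabs_minus_sym, Rabs_pos_eq; lra)).
      apply Rabs_def2 in Hd. specialize (hle s hs). lra. }
  destruct (proj1 (continuity_pt_eps _ X) cph (c - phase a X)) as [d1 [hd1 Hd1]]; [lra|].
  set (sg := profile a X).
  assert (hsg : sg * sg = 1).
  { unfold sg.
    replace (profile a X * profile a X) with (Rabs (profile a X) * Rabs (profile a X)).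
    - rewrite hone. ring.
    - rewrite <- Rabs_mult. apply Rabs_pos_eq. nra. }
  (* A tangential exit would put the solution at the equilibrium 1 or -1, and rigidity would give
     [a] that value. *)
  assert (hflux : flux a X <> 0).
  { intros e. assert (gs : g sg = 0).
    { rewrite g_inside by nra. replace (sg ^ 3 - sg) with (sg * (sg * sg - 1)) by ring.
      rewrite hsg. ring. }
    pose proof (equilibrium_rigid a sg X hX gs eq_refl e) as ea. rewrite <- ea in hsg. nra. }
  set (l := (1 + X) / X * flux a X).
  pose proof (proj1 (is_derive_Reals _ _ _) (profile_derive a X hX)) as D. fold l in D.
  assert (hl : 0 < Rabs l).
  { apply Rabs_pos_lt. unfold l. apply Rmult_integral_contrapositive_currified; [|exact hflux].
    assert (0 < (1 + X) / X) by (apply Rdiv_lt_0_compat; lra). lra. }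
  destruct (D (Rabs l) hl) as [[d2 hd2] Hd2]. simpl in Hd2.
  (* The profile is inside the strip before [X], so a nonzero derivative at [X] must point
     outwards. *)
  assert (sgl : 0 < sg * l).
  { assert (hne : sg * l <> 0).
    { apply Rmult_integral_contrapositive_currified; [intros e; rewrite e in hsg; lra|].
      intros e. rewrite e, Rabs_R0 in hl. lra. }
    destruct (Rtotal_order (sg * l) 0) as [hneg|[|]]; [exfalso|contradiction|assumption].
    set (h := - Rmin (d2 / 2) X).
    assert (hh : - d2 < h < 0 /\ - X <= h).
    { unfold h. pose proof (Rmin_l (d2 / 2) X). pose proof (Rmin_r (d2 / 2) X).
      assert (0 < Rmin (d2 / 2) X) by (apply Rmin_glb_lt; lra). lra. }
    specialize (Hd2 h ltac:(lra) ltac:(rewrite Rabs_left; lra)).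
    specialize (hbelow (X + h) ltac:(lra)).
    assert (hlt : sg * profile a (X + h) < 1).
    { apply Rle_lt_trans with (Rabs (sg * profile a (X + h))); [apply Rle_abs|].
      rewrite Rabs_mult. fold sg in hone. rewrite hone. lra. }
    fold sg in Hd2. set (q := (profile a (X + h) - sg) / h) in *.
    assert (hq : 0 < sg * q).
    { replace (sg * q) with ((1 - sg * profile a (X + h)) * / (- h)).
      - apply Rmult_lt_0_compat; [lra|apply Rinv_0_lt_compat; lra].
      - unfold q. rewrite <- hsg at 1. field. lra. }
    assert (Rabs (sg * q - sg * l) < Rabs (sg * l)) as K.
    { rewrite <- Rmult_minus_distr_l, !Rabs_mult. fold sg in hone. rewrite hone. lra. }
    rewrite (Rabs_left (sg * l)) in K by lra. apply Rabs_def2 in K. lra. }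
  set (h := Rmin (d1 / 2) (d2 / 2)).
  assert (hh : 0 < h) by (unfold h; apply Rmin_glb_lt; lra).
  pose proof (Rmin_l (d1 / 2) (d2 / 2)) as hh1. pose proof (Rmin_r (d1 / 2) (d2 / 2)) as hh2.
  fold h in hh1, hh2.
  assert (hout : 1 < Rabs (profile a (X + h))).
  { specialize (Hd2 h ltac:(lra) ltac:(rewrite Rabs_pos_eq; lra)). fold sg in Hd2.
    set (q := (profile a (X + h) - sg) / h) in *.
    assert (Rabs (sg * q - sg * l) < Rabs (sg * l)) as K.
    { rewrite <- Rmult_minus_distr_l, !Rabs_mult. fold sg in hone. rewrite hone. lra. }
    rewrite (Rabs_pos_eq (sg * l)) in K by lra. apply Rabs_def2 in K.
    assert (hq : 0 < h * (sg * q)) by (apply Rmult_lt_0_compat; lra).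
    replace (h * (sg * q)) with (sg * profile a (X + h) - sg * sg) in hq
      by (unfold q; field; lra).
    apply Rlt_le_trans with (sg * profile a (X + h)); [lra|].
    eapply Rle_trans; [apply Rle_abs|]. rewrite Rabs_mult. fold sg in hone. rewrite hone. lra. }
  specialize (Hd1 (X + h)).
  replace (X + h - X) with h in Hd1 by ring.
  specialize (Hd1 ltac:(rewrite Rabs_pos_eq; lra)). apply Rabs_def2 in Hd1.
  destruct (profile_near a (X + h) (Rabs (profile a (X + h)) - 1)) as [d3 [hd3 H3]]; [lra|lra|].
  destruct (phase_continuous_dependence a (X + h) (c - phase a (X + h))) as [d4 [hd4 H4]];
    [lra|lra|lra|].
  exists (Rmin d3 d4). split; [now apply Rmin_glb_lt|]. intros b hb hba [Y [hY [hYb hYp]]].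
  pose proof (Rmin_l d3 d4). pose proof (Rmin_r d3 d4).
  destruct (H3 b ltac:(lra) (X + h) ltac:(lra)) as [H5 _].
  specialize (H4 b hb ltac:(lra)). apply Rabs_def2 in H4.
  assert (hbout : 1 < Rabs (profile b (X + h))).
  { pose proof (Rabs_triang_inv (profile a (X + h)) (profile a (X + h) - profile b (X + h))) as T.
    replace (profile a (X + h) - (profile a (X + h) - profile b (X + h)))
      with (profile b (X + h)) in T by ring.
    rewrite (Rabs_minus_sym (profile a (X + h))) in T. lra. }
  destruct (Rle_lt_dec (X + h) Y) as [hle'|hlt].
  - specialize (hYb (X + h) ltac:(lra)). lra.
  - pose proof (phase_mono b Y (X + h) hb ltac:(lra)). fold c in hYp. lra.
Qed.

(** * Solutions staying in the strip *)

(** The final stretch of a trapped solution after its last zero, with the sign normalized to be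
    positive; abstract functions [u] and [y] let one argument serve both signs. *)
Definition settling (u y : R -> R) (S0 : R) : Prop :=
  0 < S0 /\
  (forall s, S0 <= s -> is_derive u s ((1 + s) / s * y s)) /\
  (forall s, S0 <= s -> is_derive y s ((u s ^ 3 - u s) / (1 + s) ^ 2)) /\
  (forall s, S0 <= s -> 0 < u s < 1).

Lemma settling_force_neg (u y : R -> R) (S0 s : R) : settling u y S0 ->
  S0 <= s -> (u s ^ 3 - u s) / (1 + s) ^ 2 < 0.
Proof.
  intros H0. pose proof H0 as [hS0 [du [dy hu]]]. intros hs.
  pose proof (hu s hs).
  assert (0 < / (1 + s) ^ 2) by (apply Rinv_0_lt_compat; nra).
  assert (0 < u s * (1 - u s)) by (apply Rmult_lt_0_compat; lra).
  assert (u s ^ 3 - u s < 0) by nra. unfold Rdiv. nra.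
Qed.

Lemma settling_flux_decreasing (u y : R -> R) (S0 s t : R) : settling u y S0 ->
  S0 <= s < t -> y t < y s.
Proof.
  intros H0. pose proof H0 as [hS0 [du [dy hu]]]. intros hst.
  apply Ropp_lt_cancel.
  apply (increasing_of_derive (fun x => - y x) (fun x => - ((u x ^ 3 - u x) / (1 + x) ^ 2))).
  - lra.
  - intros x hx. cont. apply (is_derive_continuity_pt _ _ _ (dy x ltac:(lra))).
  - intros x hx. exact (is_derive_opp _ _ _ (dy x ltac:(lra))).
  - intros x hx. pose proof (settling_force_neg u y S0 x H0 ltac:(lra)). lra.
Qed.

(** The flux strictly decreases. Once it is not positive, it is below some [-e] from the next unit
    of [s] on; then [u] falls by at least 1 over a length [1/e] and leaves (0,1). *)
Lemma settling_flux_pos (u y : R -> R) (S0 s : R) : settling u y S0 ->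
  S0 <= s -> 0 < y s.
Proof.
  intros H0. pose proof H0 as [hS0 [du [dy hu]]]. intros hs.
  destruct (Rlt_le_dec 0 (y s)) as [|hle]; [assumption|exfalso].
  set (t := s + 1). set (e := - y t).
  assert (he : 0 < e).
  { pose proof (settling_flux_decreasing u y S0 s t H0 ltac:(unfold t; lra)). unfold e. lra. }
  set (T := t + / e).
  assert (hi : 0 < / e) by now apply Rinv_0_lt_compat.
  assert (H : - u t - e * t <= - u T - e * T).
  { apply (nondecreasing_of_derive (fun x => - u x - e * x) (fun x => - ((1 + x) / x * y x) - e)).
    - unfold T. lra.
    - intros x hx. cont. apply (is_derive_continuity_pt _ _ _ (du x ltac:(unfold t in *; lra))).
    - intros x hx. apply is_derive_Rminus.
      + exact (is_derive_opp _ _ _ (du x ltac:(unfold t in *; lra))).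
      + auto_derive; trivial. ring.
    - intros x hx. unfold t in hx.
      pose proof (settling_flux_decreasing u y S0 t x H0 ltac:(unfold t; lra)) as hd.
      replace ((1 + x) / x) with (1 + / x) by (field; lra).
      assert (0 < / x) by (apply Rinv_0_lt_compat; lra). unfold e in *. nra. }
  unfold T in H. replace (e * (t + / e)) with (e * t + 1) in H by (field; lra).
  pose proof (hu t ltac:(unfold t; lra)). pose proof (hu (t + / e) ltac:(unfold t; lra)). lra.
Qed.

Lemma settling_mono (u y : R -> R) (S0 s t : R) : settling u y S0 ->
  S0 <= s <= t -> u s <= u t.
Proof.
  intros H0. pose proof H0 as [hS0 [du [dy hu]]]. intros hst.
  apply (nondecreasing_of_derive u (fun x => (1 + x) / x * y x)).
  - lra.
  - intros x hx. apply (is_derive_continuity_pt _ _ _ (du x ltac:(lra))).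
  - intros x hx. apply du. lra.
  - intros x hx. pose proof (settling_flux_pos u y S0 x H0 ltac:(lra)).
    assert (0 < (1 + x) / x) by (apply Rdiv_lt_0_compat; lra). nra.
Qed.

(* If [u] stayed below [1 - e], the flux would be at least of order [1/(1+s)], so that [u]
   would grow logarithmically. *)
Lemma settling_limit (u y : R -> R) (S0 e : R) : settling u y S0 ->
  0 < e -> exists S, S0 <= S /\ forall s, S <= s -> 1 - e < u s.
Proof.
  intros H0. pose proof H0 as [hS0 [du [dy hu]]]. intros he.
  destruct (classic (exists S, S0 <= S /\ 1 - e < u S)) as [[S [hS hSu]]|hno].
  { exists S. split; [exact hS|]. intros s hs. pose proof (settling_mono u y S0 S s H0 ltac:(lra)). lra. }
  exfalso.
  assert (hbnd : forall s, S0 <= s -> u s <= 1 - e).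
  { intros s hs. destruct (Rle_lt_dec (u s) (1 - e)) as [|hlt]; [assumption|].
    destruct hno. exists s. lra. }
  set (u0 := u S0). pose proof (hu S0 ltac:(lra)) as hu0. fold u0 in hu0.
  set (c := u0 * e). assert (hc : 0 < c) by (unfold c; nra).
  assert (hforce : forall s, S0 <= s -> c <= u s - u s ^ 3).
  { intros s hs. pose proof (hbnd s hs). pose proof (hu s hs).
    pose proof (settling_mono u y S0 S0 s H0 ltac:(lra)) as hm. fold u0 in hm.
    assert (c <= u s * (1 - u s)) by (unfold c; nra). nra. }
  (* By [hforce] the function [c/(1+s) - y] is nondecreasing. If it had a positive value [eta], then
     at the [T] below, where [c/(1+T) < eta], the flux would be negative. *)
  assert (hflux : forall s, S0 <= s -> c / (1 + s) <= y s).
  { intros s hs. destruct (Rle_lt_dec (c / (1 + s)) (y s)) as [|hlt]; [assumption|exfalso].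
    set (eta := c / (1 + s) - y s). assert (heta : 0 < eta) by (unfold eta; lra).
    set (T := s + c / eta).
    assert (hce : 0 < c / eta) by now apply Rdiv_lt_0_compat.
    assert (H : c / (1 + s) - y s <= c / (1 + T) - y T).
    { apply (nondecreasing_of_derive (fun x => c / (1 + x) - y x)
               (fun x => - c / (1 + x) ^ 2 - (u x ^ 3 - u x) / (1 + x) ^ 2)).
      - unfold T. lra.
      - intros x hx. cont; [lra|]. apply (is_derive_continuity_pt _ _ _ (dy x ltac:(lra))).
      - intros x hx. apply is_derive_Rminus.
        + auto_derive; [lra|]. field. lra.
        + apply dy. lra.
      - intros x hx. pose proof (hforce x ltac:(lra)).
        replace (- c / (1 + x) ^ 2 - (u x ^ 3 - u x) / (1 + x) ^ 2)
          with ((u x - u x ^ 3 - c) * / (1 + x) ^ 2) by (field; lra).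
        apply Rmult_le_pos; [lra|]. left. apply Rinv_0_lt_compat. nra. }
    fold eta in H. pose proof (settling_flux_pos u y S0 T H0 ltac:(unfold T; lra)).
    assert (c / (1 + T) < eta); [|lra].
    apply (Rmult_lt_reg_r (1 + T)); [unfold T; lra|].
    replace (c / (1 + T) * (1 + T)) with c by (field; unfold T; lra).
    unfold T. replace (eta * (1 + (s + c / eta))) with (eta * (1 + s) + c) by (field; lra). nra. }
  (* At this [T] the logarithmic growth [c ln ((1+T)/(1+S0))] equals 1, the width of the interval
     available to [u]. *)
  set (T := (1 + S0) * exp (/ c) - 1).
  assert (hT : S0 < T).
  { unfold T. pose proof (exp_ineq1 (/ c)). assert (0 < / c) by now apply Rinv_0_lt_compat. nra. }
  assert (H : u S0 - c * ln (1 + S0) <= u T - c * ln (1 + T)).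
  { apply (nondecreasing_of_derive (fun x => u x - c * ln (1 + x))
             (fun x => (1 + x) / x * y x - c * / (1 + x))).
    - lra.
    - intros x hx. apply continuity_pt_fun_minus.
      + apply (is_derive_continuity_pt _ _ _ (du x ltac:(lra))).
      + apply (is_derive_continuity_pt _ _ (c * / (1 + x))). auto_derive; [lra|]. field. lra.
    - intros x hx. apply is_derive_Rminus; [apply du; lra|]. auto_derive; [lra|]. field. lra.
    - intros x hx. pose proof (hflux x ltac:(lra)) as hf. fold (c / (1 + x)).
      replace ((1 + x) / x) with (1 + / x) by (field; lra).
      assert (0 < / x) by (apply Rinv_0_lt_compat; lra).
      pose proof (settling_flux_pos u y S0 x H0 ltac:(lra)). nra. }
  unfold T in H. replace (1 + ((1 + S0) * exp (/ c) - 1)) with ((1 + S0) * exp (/ c)) in H by ring.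
  rewrite ln_mult, ln_exp in H; [|lra|apply exp_pos].
  replace (c * (ln (1 + S0) + / c)) with (c * ln (1 + S0) + 1) in H by (field; lra).
  fold T in H. pose proof (hu T ltac:(lra)). fold u0 in H. lra.
Qed.

(** An increasing angle that never passes [k pi + pi/2] ends in one window between consecutive zeros
    of the cosine. The index [j] of the window is the number of zeros, and the clause
    [turns k a -> j = k] identifies it when that number is known. *)
Lemma eventual_phase (k : nat) (a : R) : 0 < a ->
  (forall s, 0 <= s -> Rabs (profile a s) < 1) -> ~ turns (S k) a ->
  exists j S, (j <= k)%nat /\ 0 <= S /\ (turns k a -> j = k) /\
    forall s, S <= s -> INR j * PI - PI / 2 < phase a s < INR j * PI + PI / 2.
Proof.
  intros ha hb. pose proof PI_RGT_0 as hpi.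
  assert (up : forall k, ~ turns (S k) a -> forall s, 0 <= s -> phase a s < INR k * PI + PI / 2).
  { intros i hn s hs. apply Rlt_le_trans with (phase a (s + 1)).
    - apply phase_increasing; [exact ha|lra|]. intros t ht. apply hb. lra.
    - destruct (Rle_lt_dec (phase a (s + 1)) (INR i * PI + PI / 2)) as [|hlt]; [assumption|].
      destruct hn. exists (s + 1). split; [lra|split].
      + intros t ht. apply hb. lra.
      + rewrite S_INR. lra. }
  induction k as [|k IH]; intros hn.
  - exists 0%nat, 0. split; [lia|split; [lra|split; [trivial|]]]. intros s hs.
    pose proof (phase_nonneg a s ha hs). pose proof (up 0%nat hn s hs). simpl in *. lra.
  - destruct (classic (turns (S k) a)) as [hy|hno].
    + destruct hy as [X [hX [_ hp]]].
      exists (S k), X. split; [lia|split; [exact hX|split; [trivial|]]]. intros s hs.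
      pose proof (phase_mono a X s ha ltac:(lra)). pose proof (up (S k) hn s ltac:(lra)). lra.
    + destruct (IH hno) as [j [T [hj [hT [_ H]]]]]. exists j, T.
      split; [lia|split; [exact hT|split; [contradiction|exact H]]].
Qed.

Lemma phase_window (j : nat) (x : R) : INR j * PI - PI / 2 < x < INR j * PI + PI / 2 ->
  0 < (-1) ^ j * cos x.
Proof.
  intros hx. replace x with ((x - INR j * PI) + INR j * PI) by ring.
  rewrite cos_add_INR_PI, <- Rmult_assoc, sign_square, Rmult_1_l. apply cos_gt_0; lra.
Qed.

Lemma profile_settles (j : nat) (a S : R) : 0 < a ->
  (forall s, 0 <= s -> Rabs (profile a s) < 1) -> 0 <= S ->
  (forall s, S <= s -> INR j * PI - PI / 2 < phase a s < INR j * PI + PI / 2) ->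
  (forall s, S + 1 <= s -> 0 < (-1) ^ j * flux a s) /\
  (forall e, 0 < e -> exists T, S + 1 <= T /\ forall s, T <= s -> 1 - e < (-1) ^ j * profile a s).
Proof.
  intros ha hb hS hph. set (sg := (-1) ^ j). pose proof (sign_square j) as hsg. fold sg in hsg.
  assert (du : forall s, S + 1 <= s ->
            is_derive (fun s => sg * profile a s) s ((1 + s) / s * (sg * flux a s))).
  { intros s hs. replace ((1 + s) / s * (sg * flux a s)) with (sg * ((1 + s) / s * flux a s)) by ring.
    apply is_derive_Rscal, profile_derive. lra. }
  assert (dy : forall s, S + 1 <= s -> is_derive (fun s => sg * flux a s) s
            (((sg * profile a s) ^ 3 - sg * profile a s) / (1 + s) ^ 2)).
  { intros s hs. specialize (hb s ltac:(lra)). apply Rabs_def2 in hb.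
    pose proof (flux_derive a s ltac:(lra)) as D. rewrite g_inside in D by lra.
    replace (((sg * profile a s) ^ 3 - sg * profile a s) / (1 + s) ^ 2)
      with (sg * ((profile a s ^ 3 - profile a s) / (1 + s) ^ 2)).
    - now apply is_derive_Rscal.
    - replace ((sg * profile a s) ^ 3) with ((sg * sg) * sg * profile a s ^ 3) by ring.
      rewrite hsg. field. lra. }
  assert (hu : forall s, S + 1 <= s -> 0 < sg * profile a s < 1).
  { intros s hs. destruct (polar_form a s ha ltac:(lra)) as [rho [hr [hw _]]]. split.
    - rewrite hw. replace (sg * (rho * cos (phase a s))) with (rho * (sg * cos (phase a s))) by ring.
      apply Rmult_lt_0_compat; [exact hr|]. apply phase_window, hph. lra.
    - specialize (hb s ltac:(lra)). apply Rabs_def2 in hb.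
      assert (hs2 : (sg * profile a s) * (sg * profile a s) < 1).
      { replace (sg * profile a s * (sg * profile a s)) with ((sg * sg) * (profile a s * profile a s))
          by ring. rewrite hsg. nra. }
      nra. }
  assert (hS1 : 0 < S + 1) by lra.
  split.
  - intros s. exact (settling_flux_pos _ _ (S + 1) s (conj hS1 (conj du (conj dy hu)))).
  - intros e. exact (settling_limit _ _ (S + 1) e (conj hS1 (conj du (conj dy hu)))).
Qed.

(** * Energy beyond the photon sphere *)

(** In the tortoise coordinate this is [w_x^2 / (2 P) - (1 - w^2)^2 / 4]. Its [x]-derivative along
    solutions is [- P' w_x^2 / (2 P^2)], which is nonnegative where [P] decreases, that is for
    [r >= 3m] or [s >= 1/2]. *)
Definition energy (a s : R) : R :=
  (1 + s) ^ 3 / (2 * s) * flux a s ^ 2 - (1 - profile a s ^ 2) ^ 2 / 4.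

Lemma energy_derive (a s : R) : 0 < s -> Rabs (profile a s) < 1 ->
  is_derive (energy a) s (flux a s ^ 2 * (1 + s) ^ 2 * (2 * s - 1) / (2 * s ^ 2)).
Proof.
  intros hs hb. apply Rabs_def2 in hb.
  pose proof (profile_derive a s hs) as D1.
  pose proof (flux_derive a s hs) as D2. rewrite g_inside in D2 by lra.
  unfold energy. auto_derive.
  - repeat split; try (eexists; eassumption). lra.
  - assert (E1 : Derive (fun x : R => profile a x) s = (1 + s) / s * flux a s)
      by exact (is_derive_unique _ _ _ D1).
    assert (E2 : Derive (fun x : R => flux a x) s = (profile a s ^ 3 - profile a s) / (1 + s) ^ 2)
      by exact (is_derive_unique _ _ _ D2).
    rewrite E1, E2. field. lra.
Qed.

Lemma energy_mono (a s t : R) : 2 <= s <= t ->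
  (forall x, s <= x <= t -> Rabs (profile a x) < 1) -> energy a s <= energy a t.
Proof.
  intros hst hb.
  apply (nondecreasing_of_derive _
           (fun s => flux a s ^ 2 * (1 + s) ^ 2 * (2 * s - 1) / (2 * s ^ 2))).
  - lra.
  - intros x hx. apply (is_derive_continuity_pt _ _ _ (energy_derive a x ltac:(lra) (hb x hx))).
  - intros x hx. apply energy_derive; [lra|apply hb; lra].
  - intros x hx. apply Rmult_le_pos; [|left; apply Rinv_0_lt_compat; nra].
    apply Rmult_le_pos; [|lra]. apply Rmult_le_pos; apply pow2_ge_0.
Qed.

Lemma between_of_phase (j : nat) (a s : R) : 0 < a -> 0 <= s ->
  (INR j * PI <= phase a s <= INR j * PI + PI -> (-1) ^ j * flux a s <= 0) /\
  (INR j * PI - PI <= phase a s <= INR j * PI -> 0 <= (-1) ^ j * flux a s).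
Proof.
  intros ha hs. destruct (polar_form a s ha hs) as [rho [hr [_ hv]]].
  rewrite hv. replace (phase a s) with ((phase a s - INR j * PI) + INR j * PI) by ring.
  rewrite sin_add_INR_PI.
  replace ((-1) ^ j * (- rho * ((-1) ^ j * sin (phase a s - INR j * PI))))
    with (- (((-1) ^ j * (-1) ^ j) * rho * sin (phase a s - INR j * PI))) by ring.
  rewrite sign_square. split; intros h.
  - pose proof (sin_ge_0 (phase a s - INR j * PI) ltac:(lra) ltac:(lra)). nra.
  - pose proof (sin_ge_0 (- (phase a s - INR j * PI)) ltac:(lra) ltac:(lra)) as k.
    rewrite sin_neg in k. nra.
Qed.

Lemma oriented_profile_mono (sg a s t : R) : 0 < s <= t ->
  (forall x, s <= x <= t -> 0 <= sg * flux a x) -> sg * profile a s <= sg * profile a t.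
Proof.
  intros hst hf.
  apply (nondecreasing_of_derive (fun x => sg * profile a x)
           (fun x => sg * ((1 + x) / x * flux a x))).
  - lra.
  - intros x hx. cont. apply profile_continuity. lra.
  - intros x hx. apply is_derive_Rscal, profile_derive. lra.
  - intros x hx. specialize (hf x ltac:(lra)).
    assert (0 < (1 + x) / x) by (apply Rdiv_lt_0_compat; lra).
    replace (sg * ((1 + x) / x * flux a x)) with ((1 + x) / x * (sg * flux a x)) by ring.
    now apply Rmult_le_pos; [lra|].
Qed.

(* Beyond the photon sphere ([s = 1/2]) the energy increases. A profile turning back from
   above 3/4 has gained enough at its next zero to have positive energy there, and cannot turn
   back again since the energy is negative at a turning point. *)
Lemma no_second_turn (j : nat) (b T : R) : 0 < b -> 2 <= T ->
  INR j * PI - PI / 2 < phase b T < INR j * PI + PI / 2 ->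
  3 / 4 < (-1) ^ j * profile b T -> 0 < (-1) ^ j * flux b T -> ~ turns (S (S j)) b.
Proof.
  intros hb hT hph hw hv [Y [hY [hin hYp]]]. pose proof PI_RGT_0 as hpi.
  rewrite !S_INR in hYp.
  replace ((INR j + 1 + 1) * PI) with (INR j * PI + 2 * PI) in hYp by ring.
  set (th := INR j * PI) in *.
  assert (cph : forall t, continuity_pt (phase b) t) by (intros t; now apply phase_continuity).
  assert (hTlt : phase b T < th).
  { destruct (Rlt_le_dec (phase b T) th) as [|hge]; [assumption|].
    pose proof (proj1 (between_of_phase j b T hb ltac:(lra))) as k. fold th in k.
    specialize (k ltac:(lra)). lra. }
  assert (hTY : T <= Y).
  { destruct (Rle_lt_dec T Y) as [|hlt]; [assumption|].
    pose proof (phase_mono b Y T hb ltac:(lra)). lra. }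
  (* [s0] and [s2] are consecutive turning points, at the angles [j pi] and [(j+1) pi]; [s1] is the
     zero between them. *)
  destruct (intermediate_value (phase b) T Y th hTY (fun t _ => cph t)) as [s0 [h0 e0]]; [lra|].
  destruct (intermediate_value (phase b) s0 Y (th + PI / 2)) as [s1 [h1 e1]]; auto; [lra|lra|].
  destruct (intermediate_value (phase b) s1 Y (th + PI)) as [s2 [h2 e2]]; auto; [lra|lra|].
  set (sg := (-1) ^ j) in *. pose proof (sign_square j) as hsg. fold sg in hsg.
  assert (hv0 : flux b s0 = 0).
  { destruct (polar_form b s0 hb ltac:(lra)) as [rho [_ [_ hv0]]]. rewrite hv0, e0. unfold th.
    rewrite <- (Rplus_0_l (INR j * PI)), sin_add_INR_PI, sin_0. ring. }
  assert (hv2 : flux b s2 = 0).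
  { destruct (polar_form b s2 hb ltac:(lra)) as [rho [_ [_ hv2]]]. rewrite hv2, e2. unfold th.
    rewrite Rplus_comm, sin_add_INR_PI, sin_PI. ring. }
  assert (hw1 : profile b s1 = 0).
  { destruct (polar_form b s1 hb ltac:(lra)) as [rho [_ [hw1 _]]]. rewrite hw1, e1. unfold th.
    rewrite Rplus_comm, cos_add_INR_PI, cos_PI2. ring. }
  assert (hw0 : 3 / 4 < sg * profile b s0).
  { apply Rlt_le_trans with (sg * profile b T); [exact hw|].
    apply oriented_profile_mono; [lra|]. intros x hx.
    apply (between_of_phase j b x hb ltac:(lra)). fold th.
    pose proof (phase_mono b T x hb ltac:(lra)). pose proof (phase_mono b x s0 hb ltac:(lra)). lra. }
  assert (hdown : forall x, s0 <= x <= s1 -> sg * flux b x <= 0).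
  { intros x hx. apply (between_of_phase j b x hb ltac:(lra)). fold th.
    pose proof (phase_mono b s0 x hb ltac:(lra)). pose proof (phase_mono b x s1 hb ltac:(lra)). lra. }
  assert (hmono : forall x z, s0 <= x <= z -> z <= s1 -> sg * profile b z <= sg * profile b x).
  { intros x z hxz hz. apply Ropp_le_cancel. rewrite !Ropp_mult_distr_l.
    apply oriented_profile_mono; [lra|]. intros t ht. specialize (hdown t ltac:(lra)). lra. }
  destruct (intermediate_value (fun x => - (sg * profile b x)) s0 s1 (- (1 / 2))) as [t [ht et]].
  { lra. }
  { intros x hx. cont. apply profile_continuity. lra. }
  { rewrite hw1. lra. }
  assert (sq : forall x, profile b x ^ 2 = (sg * profile b x) ^ 2).
  { intros x. replace ((sg * profile b x) ^ 2) with ((sg * sg) * profile b x ^ 2) by ring.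
    rewrite hsg. ring. }
  assert (sqv : forall x, flux b x ^ 2 = (sg * flux b x) ^ 2).
  { intros x. replace ((sg * flux b x) ^ 2) with ((sg * sg) * flux b x ^ 2) by ring.
    rewrite hsg. ring. }
  (* At a turning point above 3/4 the energy is at least [- (7/16)^2 / 4 = - 49/1024]. *)
  assert (E0 : - (48 / 1000) <= energy b s0).
  { unfold energy. rewrite hv0, sq. set (w := sg * profile b s0) in *.
    assert (w < 1).
    { pose proof (hin s0 ltac:(lra)) as k. apply Rabs_def2 in k.
      assert (w * w < 1) by (unfold w; replace (sg * profile b s0 * (sg * profile b s0))
        with ((sg * sg) * (profile b s0 * profile b s0)) by ring; rewrite hsg; nra). nra. }
    assert (0 <= 1 - w ^ 2 <= 7 / 16) by nra. nra. }
  assert (Emid : forall x, s0 <= x <= s1 -> - (48 / 1000) <= energy b x).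
  { intros x hx. apply Rle_trans with (energy b s0); [exact E0|].
    apply energy_mono; [lra|]. intros z hz. apply hin. lra. }
  (* While the oriented profile falls from 1/2 to 0 the energy rises by at least
     [(1/5)(1/2) = 1/10], more than the deficit 48/1000. On this stretch the potential term is at
     least 9/64, so the kinetic term exceeds 9/100. For [x >= 2] this gives [p >= 1/3], and
     [p (2x-1)/(2x) >= 1/4] exceeds 1/5. *)
  assert (gain : energy b t + / 5 * (sg * profile b t) <= energy b s1 + / 5 * (sg * profile b s1)).
  { apply (nondecreasing_of_derive (fun x => energy b x + / 5 * (sg * profile b x))
      (fun x => flux b x ^ 2 * (1 + x) ^ 2 * (2 * x - 1) / (2 * x ^ 2)
                + / 5 * (sg * ((1 + x) / x * flux b x)))).
    - lra.
    - intros x hx. apply continuity_pt_fun_plus.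
      + apply (is_derive_continuity_pt _ _ _
                 (energy_derive b x ltac:(lra) (hin x ltac:(lra)))).
      + cont. apply profile_continuity. lra.
    - intros x hx. apply is_derive_Rplus.
      + apply energy_derive; [lra|apply hin; lra].
      + apply is_derive_Rscal, is_derive_Rscal, profile_derive. lra.
    - intros x hx. specialize (Emid x ltac:(lra)). specialize (hdown x ltac:(lra)).
      pose proof (hmono t x ltac:(lra) ltac:(lra)) as m1.
      pose proof (hmono x s1 ltac:(lra) ltac:(lra)) as m2. rewrite hw1, Rmult_0_r in m2.
      unfold energy in Emid. rewrite sq, sqv in Emid. rewrite sqv.
      set (w := sg * profile b x) in *. set (q := - (sg * flux b x)).
      replace (sg * flux b x) with (- q) in * by (unfold q; ring).
      replace (/ 5 * (sg * ((1 + x) / x * flux b x))) with (- (/ 5 * ((1 + x) / x * q)))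
        by (unfold q; field; lra).
      replace ((- q) ^ 2) with (q ^ 2) in * by ring.
      assert (hq0 : 0 <= q) by lra.
      assert (hw2 : 9 / 16 <= (1 - w ^ 2) ^ 2).
      { assert (3 / 4 <= 1 - w ^ 2) by nra. nra. }
      set (p := (1 + x) * q). assert (hp0 : 0 <= p) by (unfold p; nra).
      assert (hp : 1 / 9 <= p ^ 2).
      { assert (k : 18 / 200 <= (1 + x) / (2 * x) * p ^ 2).
        { replace ((1 + x) / (2 * x) * p ^ 2) with ((1 + x) ^ 3 / (2 * x) * q ^ 2)
            by (unfold p; field; lra). lra. }
        assert (k2 : (1 + x) / (2 * x) <= 3 / 4).
        { apply (Rmult_le_reg_r (2 * x)); [lra|].
          replace ((1 + x) / (2 * x) * (2 * x)) with (1 + x) by (field; lra). lra. }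
        pose proof (pow2_ge_0 p). nra. }
      assert (hp1 : 1 / 3 <= p) by nra.
      replace (q ^ 2 * (1 + x) ^ 2 * (2 * x - 1) / (2 * x ^ 2) + - (/ 5 * ((1 + x) / x * q)))
        with (p * / x * (p * ((2 * x - 1) / (2 * x)) - / 5)) by (unfold p; field; lra).
      assert (hx3 : 3 / 4 <= (2 * x - 1) / (2 * x)).
      { apply (Rmult_le_reg_r (2 * x)); [lra|].
        replace ((2 * x - 1) / (2 * x) * (2 * x)) with (2 * x - 1) by (field; lra). lra. }
      apply Rmult_le_pos.
      + apply Rmult_le_pos; [exact hp0|]. left. apply Rinv_0_lt_compat. lra.
      + nra. }
  rewrite hw1 in gain. replace (sg * profile b t) with (1 / 2) in gain by lra.
  pose proof (Emid t ltac:(lra)).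
  assert (E12 : energy b s1 <= energy b s2).
  { apply energy_mono; [lra|]. intros z hz. apply hin. lra. }
  assert (E2 : energy b s2 <= 0).
  { unfold energy. rewrite hv2. pose proof (pow2_ge_0 (1 - profile b s2 ^ 2)). lra. }
  lra.
Qed.

(** What [no_second_turn] requires at a single late time [T] is an open condition, so continuous
    dependence on [0,T] suffices and the energy takes care of the rest of the half-line. *)
Lemma not_turns_open_of_trapped (k : nat) (a : R) :
  0 < a -> (forall s, 0 <= s -> Rabs (profile a s) < 1) -> ~ turns (S k) a ->
  exists d, 0 < d /\ forall b, 0 < b -> Rabs (b - a) < d -> ~ turns (S (S k)) b.
Proof.
  intros ha hin hn. destruct (eventual_phase k a ha hin hn) as [j [T0 [hj [hT0 [_ hph]]]]].
  destruct (profile_settles j a T0 ha hin hT0 hph) as [hfl hlim].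
  destruct (hlim (1 / 4)) as [T1 [hT1 hlim1]]; [lra|].
  set (T := Rmax T1 2). pose proof (Rmax_l T1 2) as m1. pose proof (Rmax_r T1 2) as m2.
  fold T in m1, m2.
  specialize (hlim1 T m1). specialize (hfl T ltac:(lra)). specialize (hph T ltac:(lra)).
  set (sg := (-1) ^ j) in *. pose proof (sign_square j) as hsg. fold sg in hsg.
  assert (hab : Rabs sg = 1).
  { pose proof (Rabs_pos sg). assert (Rabs sg * Rabs sg = 1); [|nra].
    rewrite <- Rabs_mult, hsg. apply Rabs_R1. }
  destruct (profile_near a T (Rmin (sg * profile a T - 3 / 4) (sg * flux a T)) ltac:(lra))
    as [d1 [hd1 H1]]; [apply Rmin_glb_lt; lra|].
  destruct (phase_continuous_dependence a T
    (Rmin (INR j * PI + PI / 2 - phase a T) (phase a T - (INR j * PI - PI / 2))) ha ltac:(lra))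
    as [d2 [hd2 H2]]; [apply Rmin_glb_lt; lra|].
  exists (Rmin d1 d2). split; [now apply Rmin_glb_lt|]. intros b hb hba ht.
  pose proof (Rmin_l d1 d2). pose proof (Rmin_r d1 d2).
  destruct (H1 b ltac:(lra) T ltac:(lra)) as [H3 H4]. specialize (H2 b hb ltac:(lra)).
  pose proof (Rmin_l (sg * profile a T - 3 / 4) (sg * flux a T)).
  pose proof (Rmin_r (sg * profile a T - 3 / 4) (sg * flux a T)).
  pose proof (Rmin_l (INR j * PI + PI / 2 - phase a T) (phase a T - (INR j * PI - PI / 2))).
  pose proof (Rmin_r (INR j * PI + PI / 2 - phase a T) (phase a T - (INR j * PI - PI / 2))).
  assert (K : forall x y, Rabs (x - y) = Rabs (sg * x - sg * y)).
  { intros x y. now rewrite <- Rmult_minus_distr_l, Rabs_mult, hab, Rmult_1_l. }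
  rewrite K in H3, H4. apply Rabs_def2 in H2, H3, H4.
  apply (no_second_turn j b T hb m2).
  - lra.
  - fold sg. lra.
  - fold sg. lra.
  - apply (turns_le (S (S j)) (S (S k))); [lia|exact ht].
Qed.

(** * Oscillation for small initial values *)

(* Sturm-Picone comparison with [sqrt rho * sin (ln (rho / r0) / 2)], a solution of the Euler
   equation [u'' = - u / (2 rho^2)] in [rho = 1 + s]. *)
Lemma small_profile_zero (a r0 : R) : 1 < r0 ->
  (forall s, r0 - 1 <= s <= r0 * exp (2 * PI) - 1 -> profile a s ^ 2 < 1 / 2) ->
  exists s, r0 - 1 <= s <= r0 * exp (2 * PI) - 1 /\ profile a s = 0.
Proof.
  intros hr hsm. destruct (classic (exists s, r0 - 1 <= s <= r0 * exp (2 * PI) - 1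
    /\ profile a s = 0)) as [|hno]; [assumption|exfalso].
  pose proof PI_RGT_0 as hpi.
  assert (hexp : 1 < exp (2 * PI)) by (pose proof (exp_ineq1 (2 * PI)); lra).
  set (x1 := r0 - 1) in *. set (x2 := r0 * exp (2 * PI) - 1) in *.
  assert (hx : 0 < x1 < x2) by (unfold x1, x2; nra).
  assert (hne : forall s, x1 <= s <= x2 -> profile a s <> 0).
  { intros s hs e. apply hno. now exists s. }
  set (al := fun s => ln ((1 + s) / r0) / 2).
  (* Picone's function [u u' - u^2 v / w] for [u = sqrt (1+s) sin (al s)]. It vanishes at both ends,
     where [al] is 0 and [pi]. *)
  set (F := fun s => sin (al s) * (sin (al s) + cos (al s)) / 2
                     - (1 + s) * sin (al s) ^ 2 * (flux a s / profile a s)).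
  set (F' := fun s =>
    let w := profile a s in let q := (1 + s) * flux a s / w in
    let n := sin (al s) in let c := cos (al s) in
    (2 * n * c + c ^ 2 - n ^ 2 - 4 * (n ^ 2 + n * c) * q + 4 * n ^ 2 * (1 - w ^ 2)
     + 4 * n ^ 2 * q ^ 2 * ((1 + s) / s)) / (4 * (1 + s))).
  assert (dF : forall s, x1 <= s <= x2 -> is_derive F s (F' s)).
  { intros s hs. pose proof (hne s hs) as hw. pose proof (hsm s hs) as hb.
    pose proof (profile_derive a s ltac:(lra)) as D1.
    pose proof (flux_derive a s ltac:(lra)) as D2. rewrite g_inside in D2 by nra.
    unfold F, al. auto_derive.
    - repeat split; try (eexists; eassumption); trivial; apply Rdiv_lt_0_compat; lra.
    - assert (E1 : Derive (fun x : R => profile a x) s = (1 + s) / s * flux a s)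
        by exact (is_derive_unique _ _ _ D1).
      assert (E2 : Derive (fun x : R => flux a x) s = (profile a s ^ 3 - profile a s) / (1 + s) ^ 2)
        by exact (is_derive_unique _ _ _ D2).
      rewrite E1, E2. unfold F', al. cbv zeta.
      change (ln ((1 + s) * / r0) * / 2) with (ln ((1 + s) / r0) / 2).
      generalize (sin (ln ((1 + s) / r0) / 2)) (cos (ln ((1 + s) / r0) / 2)). intros n c.
      field. repeat split; lra. }
  destruct (mean_value_open F F' x1 x2) as [c [hc E]].
  - lra.
  - intros t ht. exact (is_derive_continuity_pt _ _ _ (dF t ht)).
  - intros t ht. apply dF. lra.
  - assert (A1 : al x1 = 0).
    { unfold al, x1. replace ((1 + (r0 - 1)) / r0) with 1 by (field; lra). rewrite ln_1. field. }
    assert (A2 : al x2 = PI).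
    { unfold al, x2. replace ((1 + (r0 * exp (2 * PI) - 1)) / r0) with (exp (2 * PI)) by (field; lra).
      rewrite ln_exp. field. }
    assert (A : 0 < al c < PI).
    { rewrite <- A1 at 1. rewrite <- A2. unfold al.
      assert (hp : forall x, x1 <= x -> 0 < (1 + x) / r0)
        by (intros x hx'; apply Rdiv_lt_0_compat; lra).
      assert (hm : forall x y, x1 <= x < y -> ln ((1 + x) / r0) < ln ((1 + y) / r0)).
      { intros x y hxy. apply ln_increasing; [apply hp; lra|].
        apply Rmult_lt_compat_r; [apply Rinv_0_lt_compat|]; lra. }
      pose proof (hm x1 c ltac:(lra)). pose proof (hm c x2 ltac:(lra)). lra. }
    assert (hF : 0 < F' c).
    { unfold F'. cbv zeta. pose proof (sin_gt_0 (al c) ltac:(lra) ltac:(lra)) as hn.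
      pose proof (hsm c ltac:(lra)) as hb.
      set (n := sin (al c)) in *. set (k := cos (al c)). set (w := profile a c) in *.
      set (q := (1 + c) * flux a c / w).
      apply Rdiv_lt_0_compat; [|lra].
      assert (h1 : 1 <= (1 + c) / c).
      { replace ((1 + c) / c) with (1 + / c) by (field; lra).
        assert (0 < / c) by (apply Rinv_0_lt_compat; lra). lra. }
      assert (h2 : n ^ 2 * q ^ 2 <= n ^ 2 * q ^ 2 * ((1 + c) / c)).
      { assert (0 <= n ^ 2 * q ^ 2) by nra. nra. }
      (* With [(1+c)/c] replaced by 1, the numerator becomes [(2nq - (n+k))^2 + 2 n^2 (1 - 2 w^2)];
         here [w^2 < 1/2] enters. *)
      assert (h3 : 0 < n ^ 2 * (1 - 2 * w ^ 2)) by (apply Rmult_lt_0_compat; nra).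
      pose proof (pow2_ge_0 (2 * n * q - (n + k))). nra. }
    assert (F1 : F x1 = 0) by (unfold F; rewrite A1, sin_0; unfold Rdiv; ring).
    assert (F2 : F x2 = 0) by (unfold F; rewrite A2, sin_PI; unfold Rdiv; ring).
    rewrite F1, F2 in E. assert (0 < F' c * (x2 - x1)) by (apply Rmult_lt_0_compat; lra). lra.
Qed.

Lemma zero_solution : step 0 (fun _ => 0) (fun _ => 0) (fun _ => 0).
Proof.
  split; [reflexivity|split; [reflexivity|split; [|split; [|split]]]].
  - intros s _. apply continuity_pt_fun_const.
  - intros s _. apply continuity_pt_fun_const.
  - intros s hs. rewrite g_inside by lra. auto_derive; trivial. unfold Rdiv. ring.
  - intros s hs. auto_derive; trivial. ring.
Qed.

Lemma cos_zero_next (i : nat) (x : R) :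
  cos x = 0 -> INR i * PI - PI / 2 < x -> INR i * PI + PI / 2 <= x.
Proof.
  intros hc hx. destruct (Rle_lt_dec (INR i * PI + PI / 2) x) as [|hlt]; [assumption|].
  pose proof (phase_window i x ltac:(lra)) as H. rewrite hc in H. lra.
Qed.

Lemma phase_at_zero (a s : R) : 0 < a -> 0 <= s -> profile a s = 0 -> cos (phase a s) = 0.
Proof.
  intros ha hs e. destruct (polar_form a s ha hs) as [rho [hr [hw _]]]. rewrite e in hw. nra.
Qed.

(** Comparison with the zero solution keeps the profile below 1/2 up to [x k] when [a] is small. The
    exponents in [r] are spaced so that the windows of [small_profile_zero] are disjoint; each
    window contributes a zero, and the strict growth of the angle between windows makes these zeros
    distinct. *)
Lemma turns_small (k : nat) : exists a0, 0 < a0 /\ forall a, 0 < a < a0 -> turns k a.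
Proof.
  pose proof PI_RGT_0 as hpi.
  set (r := fun i => exp (2 * PI * (2 * INR i + 1))).
  assert (hr1 : forall i, 1 < r i).
  { intros i. unfold r. pose proof (pos_INR i).
    assert (0 < 2 * PI * (2 * INR i + 1)) by nra.
    pose proof (exp_ineq1 (2 * PI * (2 * INR i + 1))). lra. }
  assert (hrS : forall i, r i * exp (2 * PI) < r (S i)).
  { intros i. unfold r. rewrite <- exp_plus, S_INR. apply exp_increasing. nra. }
  set (x := fun i => r i * exp (2 * PI) - 1).
  assert (hexp : 1 < exp (2 * PI)) by (pose proof (exp_ineq1 (2 * PI)); lra).
  assert (hxr : forall i, 0 < r i - 1 < x i).
  { intros i. unfold x. pose proof (hr1 i). nra. }
  assert (hmono : forall i, (i <= k)%nat -> x i <= x k).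
  { intros i hik. induction hik as [|l hl IH]; [lra|].
    pose proof (hrS l). pose proof (hxr (S l)). unfold x in *. lra. }
  pose proof (hxr k) as hk. pose proof (weight_ge (x k) ltac:(lra)) as hw.
  exists (/ (4 * weight (x k))). split; [apply Rinv_0_lt_compat; nra|]. intros a ha.
  assert (hsm : forall s, 0 <= s <= x k -> Rabs (profile a s) < 1 / 2).
  { intros s hs.
    pose proof (solution_diff a 0 _ _ _ _ s (profile_solution a) zero_solution ltac:(lra)) as H.
    rewrite !Rminus_0_r, (Rabs_pos_eq a) in H by lra.
    pose proof (weight_mono s (x k) hs) as hm.
    destruct ha as [ha ha']. apply (Rmult_lt_compat_r (4 * weight (x k))) in ha'; [|nra].
    rewrite Rinv_l in ha' by nra. nra. }
  assert (hph : forall i, (i <= k)%nat -> INR i * PI + PI / 2 <= phase a (x i)).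
  { induction i as [|i IH]; intros hi.
    - pose proof (hmono 0%nat hi). pose proof (hxr 0%nat).
      destruct (small_profile_zero a (r 0%nat) (hr1 _)) as [s [hs e]].
      { intros s hs. fold (x 0%nat) in hs. specialize (hsm s ltac:(lra)).
        apply Rabs_def2 in hsm. nra. }
      fold (x 0%nat) in hs.
      pose proof (phase_at_zero a s ltac:(lra) ltac:(lra) e) as hc.
      pose proof (phase_nonneg a s ltac:(lra) ltac:(lra)).
      pose proof (cos_zero_next 0 _ hc ltac:(simpl; lra)).
      pose proof (phase_mono a s (x 0%nat) ltac:(lra) ltac:(lra)). lra.
    - specialize (IH ltac:(lia)). pose proof (hmono (S i) hi). pose proof (hxr (S i)).
      pose proof (hmono i ltac:(lia)). pose proof (hxr i).
      destruct (small_profile_zero a (r (S i)) (hr1 _)) as [s [hs e]].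
      { intros s hs. fold (x (S i)) in hs. specialize (hsm s ltac:(lra)).
        apply Rabs_def2 in hsm. nra. }
      fold (x (S i)) in hs.
      pose proof (phase_at_zero a s ltac:(lra) ltac:(lra) e) as hc.
      pose proof (hrS i) as hgap.
      assert (hlt : phase a (x i) < phase a s).
      { apply phase_increasing; [lra|unfold x in *; lra|]. intros u hu.
        specialize (hsm u ltac:(lra)). lra. }
      pose proof (cos_zero_next (S i) _ hc ltac:(rewrite S_INR; lra)).
      pose proof (phase_mono a s (x (S i)) ltac:(lra) ltac:(lra)). lra. }
  exists (x k). split; [lra|split].
  - intros s hs. specialize (hsm s hs). lra.
  - pose proof (hph k (le_n k)). lra.
Qed.

(** * The shooting argument *)

Definition good (n : nat) (a : R) : Prop :=
  0 < a < 1 /\ (forall s, 0 <= s -> Rabs (profile a s) < 1) /\ turns n a /\ ~ turns (S n) a.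

(** Elements of [E] accumulate at its supremum [b], and each unwanted case meets an openness lemma:
    [b = a], or [b] trapped with at most [n] zeros, contradicts [not_turns_open_of_trapped]; an exit
    contradicts [not_turns_open_of_exit]; [n+2] zeros at [b] would by [turns_open] persist beyond
    [b]. *)
Lemma good_next (n : nat) (a : R) : good n a -> exists b, b < a /\ good (S n) b.
Proof.
  intros [ha [hin [_ hn]]].
  set (E := fun b => 0 < b < a /\ turns (S (S n)) b).
  destruct (turns_small (S (S n))) as [a0 [ha0 hsmall]].
  set (b0 := Rmin (a / 2) (a0 / 2)).
  assert (hb0 : 0 < b0) by (unfold b0; apply Rmin_glb_lt; lra).
  pose proof (Rmin_l (a / 2) (a0 / 2)) as m1. pose proof (Rmin_r (a / 2) (a0 / 2)) as m2.
  fold b0 in m1, m2.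
  assert (hE0 : E b0) by (split; [lra|apply hsmall; lra]).
  destruct (completeness E) as [b [hub hlub]].
  { exists a. intros y [hy _]. lra. }
  { now exists b0. }
  pose proof (hub b0 hE0) as hbb0.
  assert (approx : forall d, 0 < d -> exists y, E y /\ Rabs (y - b) < d).
  { intros d hd. destruct (classic (exists y, E y /\ b - d < y)) as [[y [hy hyd]]|hno].
    - exists y. split; [exact hy|]. specialize (hub y hy). apply Rabs_def1; lra.
    - exfalso. assert (b <= b - d); [|lra]. apply hlub. intros y hy.
      destruct (Rle_lt_dec y (b - d)) as [|hlt]; [assumption|]. destruct hno. now exists y. }
  assert (hba : b < a).
  { assert (b <= a) as [hlt|e] by (apply hlub; intros y [hy _]; lra); [exact hlt|exfalso].
    destruct (not_turns_open_of_trapped n a ltac:(lra) hin hn) as [d [hd Hd]].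
    destruct (approx d hd) as [y [[hy hty] hyd]]. rewrite e in hyd. apply (Hd y); trivial. lra. }
  assert (hnb : ~ turns (S (S n)) b).
  { intros ht. destruct (turns_open _ b ltac:(lra) ht) as [d [hd Hd]].
    set (y := b + Rmin (d / 2) ((a - b) / 2)).
    pose proof (Rmin_l (d / 2) ((a - b) / 2)). pose proof (Rmin_r (d / 2) ((a - b) / 2)).
    assert (0 < Rmin (d / 2) ((a - b) / 2)) by (apply Rmin_glb_lt; lra).
    assert (hy : E y).
    { split; [unfold y; lra|]. apply Hd; unfold y; [lra|].
      match goal with |- Rabs ?z < d => replace z with (Rmin (d / 2) ((a - b) / 2)) by ring end.
      rewrite Rabs_pos_eq; lra. }
    specialize (hub y hy). unfold y in hub. lra. }
  assert (hinb : forall s, 0 <= s -> Rabs (profile b s) < 1).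
  { destruct (classic (forall s, 0 <= s -> Rabs (profile b s) < 1)) as [|hno]; [assumption|].
    destruct (not_turns_open_of_exit _ b ltac:(lra) hno hnb) as [d [hd Hd]].
    destruct (approx d hd) as [y [[hy hty] hyd]]. destruct (Hd y); trivial. lra. }
  exists b. split; [exact hba|]. split; [lra|split; [exact hinb|split; [|exact hnb]]].
  destruct (classic (turns (S n) b)) as [|hno]; [assumption|exfalso].
  destruct (not_turns_open_of_trapped n b ltac:(lra) hinb hno) as [d [hd Hd]].
  destruct (approx d hd) as [y [[hy hty] hyd]]. apply (Hd y); trivial. lra.
Qed.

(** * The explicit solution *)

Definition explicit_c : R := (3 + sqrt 3) / 2.

Definition explicit_w (s : R) : R := (explicit_c - 1 - s) / (s + 3 * explicit_c - 2).
Definition explicit_v (s : R) : R :=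
  - (4 * explicit_c - 3) * s / ((1 + s) * (s + 3 * explicit_c - 2) ^ 2).

Lemma explicit_c_bound : 2 < explicit_c.
Proof.
  unfold explicit_c. assert (1 < sqrt 3) by (rewrite <- sqrt_1; apply sqrt_lt_1; lra). lra.
Qed.

Lemma explicit_c_root : 2 * explicit_c ^ 2 - 6 * explicit_c + 3 = 0.
Proof.
  unfold explicit_c. pose proof (sqrt_sqrt 3 ltac:(lra)) as h.
  replace (2 * ((3 + sqrt 3) / 2) ^ 2 - 6 * ((3 + sqrt 3) / 2) + 3)
    with ((sqrt 3 * sqrt 3 - 3) / 2) by field. rewrite h. field.
Qed.

Lemma explicit_w_start : explicit_w 0 = (1 + sqrt 3) / (3 * sqrt 3 + 5).
Proof.
  unfold explicit_w, explicit_c. pose proof (sqrt_pos 3). field. lra.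
Qed.

Lemma explicit_w_range (s : R) : 0 <= s -> Rabs (explicit_w s) < 1.
Proof.
  intros hs. pose proof explicit_c_bound as hc. unfold explicit_w.
  set (d := s + 3 * explicit_c - 2). assert (hd : 0 < d) by (unfold d; lra).
  apply Rabs_def1; apply (Rmult_lt_reg_r d); trivial.
  - replace ((explicit_c - 1 - s) / d * d) with (explicit_c - 1 - s) by (field; lra).
    unfold d. lra.
  - replace ((explicit_c - 1 - s) / d * d) with (explicit_c - 1 - s) by (field; lra).
    unfold d. lra.
Qed.

Lemma explicit_solution : step (explicit_w 0) explicit_w explicit_w explicit_v.
Proof.
  pose proof explicit_c_bound as hc. pose proof explicit_c_root as hroot.
  split; [reflexivity|split; [|split; [|split; [|split]]]].
  - unfold explicit_v. field. lra.
  - intros s hs. unfold explicit_w. cont. lra.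
  - intros s hs. unfold explicit_v. cont.
    apply Rmult_integral_contrapositive_currified; [lra|]. apply pow_nonzero. lra.
  - intros s hs. pose proof (explicit_w_range s ltac:(lra)) as hb. apply Rabs_def2 in hb.
    rewrite g_inside by lra. unfold explicit_v, explicit_w.
    set (c := explicit_c) in *. auto_derive.
    + apply Rmult_integral_contrapositive_currified; [lra|].
      apply (pow_nonzero (s + 3 * c - 2) 2). lra.
    (* The defect in the equation is a multiple of [2 c^2 - 6 c + 3]; its vanishing is what
       determines [c]. *)
    + apply Rminus_diag_uniq.
      transitivity ((2 * c ^ 2 - 6 * c + 3)
                    * ((4 * c - 3) / ((1 + s) ^ 2 * (s + 3 * c - 2) ^ 3))).
      * field. lra.
      * rewrite hroot. ring.
  - intros s hs. unfold explicit_v, explicit_w. set (c := explicit_c) in *.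
    auto_derive; [lra|]. field. lra.
Qed.

Lemma explicit_profile (s : R) : 0 <= s -> profile (explicit_w 0) s = explicit_w s.
Proof.
  intros hs.
  pose proof (solution_diff _ _ _ _ _ _ s (profile_solution (explicit_w 0)) explicit_solution hs)
    as H.
  rewrite Rminus_diag, Rabs_R0, Rmult_0_r, Rmult_0_l in H.
  destruct (Req_dec (profile (explicit_w 0) s) (explicit_w s)) as [|hne]; [assumption|].
  pose proof (Rabs_pos_lt (profile (explicit_w 0) s - explicit_w s) ltac:(lra)). lra.
Qed.

Lemma good_explicit : good 1 (explicit_w 0).
Proof.
  pose proof explicit_c_bound as hc. pose proof PI_RGT_0 as hpi.
  assert (hin : forall s, 0 <= s -> Rabs (profile (explicit_w 0) s) < 1).
  { intros s hs. rewrite explicit_profile by lra. now apply explicit_w_range. }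
  assert (ha : 0 < explicit_w 0 < 1).
  { split.
    - unfold explicit_w. apply Rdiv_lt_0_compat; lra.
    - pose proof (explicit_w_range 0 ltac:(lra)) as h. apply Rabs_def2 in h. lra. }
  destruct ha as [ha ha1]. set (a := explicit_w 0) in *.
  assert (hz : forall s, 0 <= s -> profile a s = 0 -> s = explicit_c - 1).
  { intros s hs e. unfold a in e. rewrite explicit_profile in e by lra. unfold explicit_w in e.
    apply Rmult_integral in e as [e|e]; [lra|].
    exfalso. apply (Rinv_neq_0_compat (s + 3 * explicit_c - 2)); [lra|exact e]. }
  assert (hcos : forall s, 0 <= s -> cos (phase a s) = 0 -> s = explicit_c - 1).
  { intros s hs e. apply hz; trivial. destruct (polar_form a s ha hs) as [rho [_ [hw _]]].
    rewrite hw, e. ring. }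
  split; [lra|split; [exact hin|split]].
  - exists explicit_c. split; [lra|split].
    + intros s hs. apply hin. lra.
    + assert (e : profile a (explicit_c - 1) = 0).
      { unfold a. rewrite explicit_profile by lra. unfold explicit_w, Rdiv. ring. }
      pose proof (phase_at_zero a (explicit_c - 1) ha ltac:(lra) e) as h0.
      pose proof (phase_nonneg a (explicit_c - 1) ha ltac:(lra)).
      pose proof (cos_zero_next 0 _ h0 ltac:(simpl; lra)) as h1.
      assert (phase a (explicit_c - 1) < phase a explicit_c).
      { apply phase_increasing; [exact ha|lra|]. intros u hu. apply hin. lra. }
      simpl in *. lra.
  - intros [Y [hY [_ hp]]]. simpl in hp.
    assert (cph : forall t, continuity_pt (phase a) t) by (intros t; now apply phase_continuity).
    (* A second turn would make the angle take the values [pi/2] and [3 pi/2], both at the only zero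
       [explicit_c - 1]. *)
    destruct (intermediate_value (phase a) 0 Y (PI / 2) hY (fun t _ => cph t)) as [t1 [h1 e1]].
    { rewrite phase_start. lra. }
    destruct (intermediate_value (phase a) 0 Y (PI / 2 + PI) hY (fun t _ => cph t))
      as [t2 [h2 e2]].
    { rewrite phase_start. lra. }
    assert (k1 : t1 = explicit_c - 1) by (apply hcos; [lra|]; rewrite e1; apply cos_PI2).
    assert (k2 : t2 = explicit_c - 1).
    { apply hcos; [lra|]. rewrite e2, neg_cos, cos_PI2. ring. }
    rewrite k1 in e1. rewrite k2 in e2. lra.
Qed.

(** * Zeros and limit of a good solution *)

Lemma phase_zero_levels (i : nat) (x : R) :
  0 <= x < INR i * PI + PI / 2 -> cos x = 0 ->
  exists j, (j < i)%nat /\ x = INR j * PI + PI / 2.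
Proof.
  pose proof PI_RGT_0. induction i as [|i IH]; intros hx hc.
  - pose proof (phase_window 0 x ltac:(simpl in *; lra)). rewrite hc in *. lra.
  - rewrite S_INR in hx. destruct (Rtotal_order x (INR i * PI + PI / 2)) as [h|[h|h]].
    + destruct (IH ltac:(lra) hc) as [j [hj e]]. exists j. split; [lia|exact e].
    + exists i. split; [lia|exact h].
    + pose proof (phase_window (S i) x ltac:(rewrite S_INR; lra)). rewrite hc in *. lra.
Qed.

(** The strictly increasing angle puts the zeros in bijection with the levels [j pi + pi/2],
    [j < n]; the list is built level by level. *)
Lemma good_zeros (n : nat) (a : R) : good n a ->
  exists l : list R, NoDup l /\ length l = n /\
    forall s, In s l <-> 0 < s /\ profile a s = 0.
Proof.
  intros [ha [hin [[X [hX [_ hXp]]] hn]]]. pose proof PI_RGT_0 as hpi.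
  assert (cph : forall t, continuity_pt (phase a) t)
    by (intros t; apply phase_continuity; lra).
  assert (inj : forall s t, 0 <= s -> 0 <= t -> phase a s = phase a t -> s = t).
  { intros s t hs ht e. destruct (Rtotal_order s t) as [h|[h|h]]; [exfalso|assumption|exfalso].
    - assert (phase a s < phase a t); [|lra].
      apply phase_increasing; [lra|lra|]. intros u hu. apply hin. lra.
    - assert (phase a t < phase a s); [|lra].
      apply phase_increasing; [lra|lra|]. intros u hu. apply hin. lra. }
  assert (L : forall i, (i <= n)%nat -> exists l : list R, NoDup l /\ length l = i /\
    forall s, In s l <-> 0 < s /\ exists j, (j < i)%nat /\ phase a s = INR j * PI + PI / 2).
  { induction i as [|i IH]; intros hi.
    - exists nil. split; [constructor|split; [reflexivity|]]. intros s. split; [intros []|].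
      intros [_ [j [hj _]]]. lia.
    - destruct (IH ltac:(lia)) as [l [hnd [hl hm]]].
      destruct (intermediate_value (phase a) 0 X (INR i * PI + PI / 2) hX (fun t _ => cph t))
        as [t [ht e]].
      { rewrite phase_start. pose proof (pos_INR i).
        assert (INR i + 1 <= INR n) by (rewrite <- S_INR; now apply le_INR). nra. }
      assert (htp : 0 < t).
      { destruct ht as [[|<-] _]; [assumption|]. rewrite phase_start in e.
        pose proof (pos_INR i). nra. }
      exists (t :: l). split; [|split].
      + constructor; [|exact hnd]. intros hin'. apply hm in hin' as [_ [j [hj e']]].
        rewrite e in e'. apply lt_INR in hj. nra.
      + simpl. now rewrite hl.
      + intros s. simpl. rewrite hm. split.
        * intros [<-|[hs [j [hj e']]]].
          -- split; [exact htp|]. exists i. split; [lia|exact e].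
          -- split; [exact hs|]. exists j. split; [lia|exact e'].
        * intros [hs [j [hj e']]]. destruct (Nat.eq_dec j i) as [->|hji].
          -- left. apply inj; lra.
          -- right. split; [exact hs|]. exists j. split; [lia|exact e']. }
  destruct (L n (le_n n)) as [l [hnd [hl hm]]]. exists l.
  split; [exact hnd|split; [exact hl|]]. intros s. rewrite hm.
  split; intros [hs H]; (split; [exact hs|]).
  - destruct H as [j [_ e]]. destruct (polar_form a s ltac:(lra) ltac:(lra)) as [rho [_ [hw _]]].
    rewrite hw, e, Rplus_comm, cos_add_INR_PI, cos_PI2. ring.
  - apply phase_zero_levels.
    + split; [apply phase_nonneg; lra|].
      apply Rlt_le_trans with (phase a (s + 1)).
      * apply phase_increasing; [lra|lra|]. intros u hu. apply hin. lra.
      * destruct (Rle_lt_dec (phase a (s + 1)) (INR n * PI + PI / 2)) as [|hlt]; [assumption|].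
        destruct hn. exists (s + 1). split; [lra|split].
        -- intros u hu. apply hin. lra.
        -- rewrite S_INR. lra.
    + apply phase_at_zero; lra.
Qed.

Lemma good_limit (n : nat) (a e : R) : good n a -> 0 < e ->
  exists T, 0 < T /\ forall s, T <= s -> Rabs (profile a s - (-1) ^ n) < e.
Proof.
  intros [ha [hin [ht hn]]] he.
  destruct (eventual_phase n a ltac:(lra) hin hn) as [j [S [_ [hS [hj hph]]]]].
  rewrite (hj ht) in hph.
  destruct (profile_settles n a S ltac:(lra) hin hS hph) as [_ H].
  destruct (H e he) as [T [hT HT]]. exists T. split; [lra|]. intros s hs.
  specialize (HT s hs). specialize (hin s ltac:(lra)).
  pose proof (sign_square n) as hsg. set (sg := (-1) ^ n) in *.
  assert (hab : Rabs sg = 1).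
  { pose proof (Rabs_pos sg). assert (Rabs sg * Rabs sg = 1); [|nra].
    rewrite <- Rabs_mult, hsg. apply Rabs_R1. }
  replace (Rabs (profile a s - sg)) with (Rabs (sg * profile a s - 1)).
  - pose proof (Rle_abs (sg * profile a s)) as k. rewrite Rabs_mult, hab in k.
    apply Rabs_def1; lra.
  - transitivity (Rabs sg * Rabs (profile a s - sg)); [|rewrite hab; ring].
    rewrite <- Rabs_mult. f_equal. rewrite Rmult_minus_distr_l, hsg. ring.
Qed.

(** * The area radius as a function of the tortoise coordinate *)

(** Caratheodory's form of the derivative: the difference quotient [q] of [f], completed by [l], is
    continuous at [h x], and the difference quotient of [h] is [/ q (h y)]. *)
Lemma inverse_derive (f h : R -> R) (x l : R) :
  continuity_pt h x -> is_derive f (h x) l -> l <> 0 -> (forall y, f (h y) = y) ->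
  is_derive h x (/ l).
Proof.
  intros ch df hl hinv.
  set (q := fun y => if Req_EM_T y (h x) then l else (f y - f (h x)) / (y - h x)).
  assert (cq : continuity_pt q (h x)).
  { apply continuity_pt_eps. intros e he.
    pose proof (proj1 (is_derive_Reals _ _ _) df) as D.
    destruct (D e he) as [d H]. exists d. split; [apply cond_pos|].
    intros y hy. unfold q. destruct (Req_EM_T (h x) (h x)) as [_|n]; [|lra].
    destruct (Req_EM_T y (h x)) as [_|ne].
    - now rewrite Rminus_diag, Rabs_R0.
    - specialize (H (y - h x) ltac:(lra) hy).
      now replace (h x + (y - h x)) with y in H by ring. }
  assert (qx : q (h x) = l) by (unfold q; destruct (Req_EM_T (h x) (h x)); lra).
  assert (cr : continuity_pt (fun y => / q (h y)) x).
  { apply continuity_pt_inv_fun; [|now rewrite qx].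
    now apply (continuity_pt_fun_comp h q). }
  apply is_derive_Reals. intros e he.
  destruct (proj1 (continuity_pt_eps _ x) cr e he) as [d [hd H]].
  exists (mkposreal d hd). intros k hk hkd. simpl in hkd.
  specialize (H (x + k)). replace (x + k - x) with k in H by ring. specialize (H hkd).
  rewrite qx in H.
  assert (hne : h (x + k) <> h x).
  { intros e'. apply hk. pose proof (hinv (x + k)) as h1. rewrite e', hinv in h1. lra. }
  replace ((h (x + k) - h x) / k) with (/ q (h (x + k))); [exact H|].
  unfold q. destruct (Req_EM_T (h (x + k)) (h x)); [contradiction|].
  rewrite !hinv. replace (x + k - x) with k by ring. field. lra.
Qed.

(** Since [xs] has derivative above 1 it expands distances. Hence [r] is 1-Lipschitz, which provides
    the continuity needed to differentiate the inverse. *)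
Lemma tortoise_facts (m : R) (r xs : R -> R) : 0 < m ->
  (forall rho, 2 * m < rho -> is_derive xs rho (/ (1 - 2 * m / rho))) ->
  (forall rho, 2 * m < rho -> r (xs rho) = rho) ->
  (forall x, 2 * m < r x /\ xs (r x) = x) ->
  (forall x y, 2 * m < x < y -> y - x < xs y - xs x) /\
  (forall x, is_derive r x (1 - 2 * m / r x)).
Proof.
  intros hm dxs h1 h2.
  assert (hlap : forall rho, 2 * m < rho -> 0 < 1 - 2 * m / rho < 1).
  { intros rho hr. assert (0 < 2 * m / rho) by (apply Rdiv_lt_0_compat; lra).
    assert (2 * m / rho < 1); [|lra]. apply (Rmult_lt_reg_r rho); [lra|].
    replace (2 * m / rho * rho) with (2 * m) by (field; lra). lra. }
  assert (gap : forall x y, 2 * m < x < y -> y - x < xs y - xs x).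
  { intros x y hxy. assert (xs x - x < xs y - y); [|lra].
    apply (increasing_of_derive (fun t => xs t - t) (fun t => / (1 - 2 * m / t) - 1)).
    - lra.
    - intros t ht. cont. exact (is_derive_continuity_pt _ _ _ (dxs t ltac:(lra))).
    - intros t ht. apply is_derive_Rminus; [apply dxs; lra|]. apply @is_derive_id.
    - intros t ht. pose proof (hlap t ltac:(lra)).
      assert (1 < / (1 - 2 * m / t)); [|lra].
      rewrite <- Rinv_1. apply Rinv_lt_contravar; lra. }
  split; [exact gap|]. intros x.
  assert (cr : continuity_pt r x).
  { apply continuity_pt_eps. intros e he. exists e. split; [exact he|]. intros y hy.
    eapply Rle_lt_trans; [|exact hy].
    destruct (h2 x) as [hx ex]. destruct (h2 y) as [hy' ey].
    destruct (Rtotal_order (r x) (r y)) as [h|[h|h]].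
    - pose proof (gap (r x) (r y) ltac:(lra)). rewrite !Rabs_pos_eq; lra.
    - rewrite h, Rminus_diag, Rabs_R0. apply Rabs_pos.
    - pose proof (gap (r y) (r x) ltac:(lra)). rewrite !Rabs_left; lra. }
  destruct (h2 x) as [hx ex]. pose proof (hlap _ hx).
  replace (1 - 2 * m / r x) with (/ / (1 - 2 * m / r x)) by (apply Rinv_inv).
  apply (inverse_derive xs r); trivial.
  - now apply dxs.
  - apply Rinv_neq_0_compat. lra.
  - intros y. apply h2.
Qed.

(** * Smoothness *)

(** Polynomials in three functions. For [W], [W_x] and [1/r] this algebra is closed under
    differentiation, so all derivatives of [W] exist at once. *)
Inductive generated (A B C : R -> R) : (R -> R) -> Prop :=
| gen_A : generated A B C A
| gen_B : generated A B C B
| gen_C : generated A B C C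
| gen_const c : generated A B C (fun _ => c)
| gen_plus f h : generated A B C f -> generated A B C h -> generated A B C (fun x => f x + h x)
| gen_mult f h : generated A B C f -> generated A B C h -> generated A B C (fun x => f x * h x).

Lemma generated_smooth (A B C A' B' C' : R -> R) :
  (forall x, is_derive A x (A' x)) -> (forall x, is_derive B x (B' x)) ->
  (forall x, is_derive C x (C' x)) ->
  generated A B C A' -> generated A B C B' -> generated A B C C' -> smooth A.
Proof.
  intros dA dB dC gA gB gC.
  assert (D : forall f, generated A B C f ->
            exists f', generated A B C f' /\ forall x, is_derive f x (f' x)).
  { intros f hf. induction hf as [| | |c|f h _ [f' [gf df]] _ [h' [gh dh]]
                                  |f h hf [f' [gf df]] hh [h' [gh dh]]].
    - now exists A'.
    - now exists B'.
    - now exists C'.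
    - exists (fun _ => 0). split; [constructor|]. intros x. apply @is_derive_const.
    - exists (fun x => f' x + h' x). split; [now constructor|].
      intros x. now apply is_derive_Rplus.
    - exists (fun x => f' x * h x + f x * h' x). split.
      + apply gen_plus; now apply gen_mult.
      + intros x. apply (is_derive_mult f h x); trivial. intros; apply Rmult_comm. }
  assert (N : forall k, exists h, generated A B C h /\ forall x, Derive_n A k x = h x).
  { induction k as [|k [h [gh eh]]].
    - exists A. split; [constructor|reflexivity].
    - destruct (D h gh) as [h' [gh' dh]]. exists h'. split; [exact gh'|]. intros x. simpl.
      rewrite (Derive_ext _ h) by exact eh. now apply is_derive_unique. }
  intros [|k] x; simpl; [trivial|].
  destruct (N k) as [h [gh eh]]. destruct (D h gh) as [h' [_ dh]].
  apply (ex_derive_ext h); [intros; now rewrite eh|]. exists (h' x). apply dh.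
Qed.

(** * Solutions in the tortoise coordinate *)

Lemma stationary_of_good (m : R) (r : R -> R) (n : nat) (a : R) :
  0 < m -> tortoise_radius m r -> good n a ->
  let W := fun x => profile a (r x / (2 * m) - 1) in
  smooth_stationary_solution m r W /\ (forall x, -1 <= W x <= 1) /\
  is_lim W m_infty (Finite a) /\ is_lim W p_infty (Finite ((-1) ^ n)) /\
  has_exactly_n_zeros W n.
Proof.
  intros hm [xs [dxs [h1 h2]]] hg W. pose proof hg as [ha [hin _]].
  destruct (tortoise_facts m r xs hm dxs h1 h2) as [gap dr].
  set (S := fun x => r x / (2 * m) - 1).
  assert (hr : forall x, 2 * m < r x) by (intros x; apply h2).
  assert (hS : forall x, 0 < S x).
  { intros x. unfold S. specialize (hr x).
    assert (1 < r x / (2 * m)); [|lra]. apply (Rmult_lt_reg_r (2 * m)); [lra|].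
    replace (r x / (2 * m) * (2 * m)) with (r x) by (field; lra). lra. }
  assert (hrange : forall x, -1 < W x < 1).
  { intros x. pose proof (hin (S x) (Rlt_le _ _ (hS x))) as h. apply Rabs_def2 in h.
    unfold W. fold (S x). lra. }
  assert (dS : forall x, is_derive S x (/ (2 * m) * (1 - 2 * m / r x))).
  { intros x. unfold S. pose proof (dr x) as D. auto_derive; [eexists; exact D|].
    assert (E : Derive (fun y : R => r y) x = 1 - 2 * m / r x) by exact (is_derive_unique _ _ _ D).
    rewrite E. ring. }
  (* [V] is [W_x]: the factor [1 - 2m/r = s/(1+s)] in the derivative of [S] cancels the singular
     coefficient of the system. *)
  set (V := fun x => / (2 * m) * flux a (S x)).
  set (U := fun x => / r x).
  set (V' := fun x => U x * U x * (1 + - (2 * m) * U x) * (W x * W x * W x + -1 * W x)).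
  assert (dW : forall x, is_derive W x (V x)).
  { intros x. replace (V x)
      with (scal (/ (2 * m) * (1 - 2 * m / r x)) ((1 + S x) / S x * flux a (S x))).
    - apply (is_derive_comp (profile a) S); [|apply dS]. now apply profile_derive.
    - unfold scal; simpl; unfold mult; simpl. specialize (hS x). specialize (hr x).
      unfold V. unfold S in hS |- *.
      field. repeat split; lra. }
  assert (dV : forall x, is_derive V x (V' x)).
  { intros x. pose proof (hrange x) as hw.
    replace (V' x)
      with (/ (2 * m) * scal (/ (2 * m) * (1 - 2 * m / r x))
                          ((W x ^ 3 - W x) / (1 + S x) ^ 2)).
    - apply is_derive_Rscal. apply (is_derive_comp (flux a) S); [|apply dS].
      rewrite <- (g_inside (W x)) by lra. now apply flux_derive.
    - unfold scal; simpl; unfold mult; simpl. specialize (hr x).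
      unfold V', U, S. field. lra. }
  assert (dU : forall x, is_derive U x (- 1 * (U x * U x) * (1 + - (2 * m) * U x))).
  { intros x. unfold U. pose proof (dr x) as D. specialize (hr x).
    auto_derive; [split; [eexists; exact D|split; [lra|trivial]]|].
    assert (E : Derive (fun y : R => r y) x = 1 - 2 * m / r x) by exact (is_derive_unique _ _ _ D).
    rewrite E. field. lra. }
  split; [split|split; [|split; [|split]]].
  - apply (generated_smooth W V U V V' (fun x => - 1 * (U x * U x) * (1 + - (2 * m) * U x)));
      trivial; unfold V'; repeat constructor.
  - intros t x. specialize (hr x).
    assert (E0 : Derive_n (fun _ : R => W x) 2 t = 0).
    { simpl. rewrite (Derive_ext _ (fun _ => 0)) by (intros; apply Derive_const).
      apply Derive_const. }
    assert (E2 : Derive_n (fun y : R => W y) 2 x = V' x).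
    { simpl. rewrite (Derive_ext _ V) by (intros; now apply is_derive_unique).
      now apply is_derive_unique. }
    rewrite E0, E2. unfold P, V', U. field. lra.
  - intros x. specialize (hrange x). lra.
  - apply is_lim_spec. intros [e he].
    destruct (proj1 (continuity_pt_eps _ 0) (profile_continuity a 0 (Rle_refl 0)) e he)
      as [d [hd Hd]].
    exists (xs (2 * m * (1 + d))). intros x hx. simpl.
    specialize (Hd (S x)). rewrite profile_start, Rminus_0_r in Hd. apply Hd.
    rewrite Rabs_pos_eq by (apply Rlt_le, hS).
    assert (hlt : r x < 2 * m * (1 + d)).
    { destruct (Rlt_le_dec (r x) (2 * m * (1 + d))) as [|[hgt|e']]; [assumption|exfalso|exfalso].
      - pose proof (gap (2 * m * (1 + d)) (r x) ltac:(nra)) as k.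
        destruct (h2 x) as [_ ex]. rewrite ex in k. lra.
      - destruct (h2 x) as [_ ex]. rewrite <- e' in ex. lra. }
    unfold S. apply (Rmult_lt_reg_r (2 * m)); [lra|].
    replace ((r x / (2 * m) - 1) * (2 * m)) with (r x - 2 * m) by (field; lra). lra.
  - apply is_lim_spec. intros [e he]. destruct (good_limit n a e hg he) as [T [hT HT]].
    exists (xs (2 * m * (1 + T))). intros x hx. simpl. apply HT.
    assert (hlt : 2 * m * (1 + T) <= r x).
    { destruct (Rle_lt_dec (2 * m * (1 + T)) (r x)) as [|hgt]; [assumption|exfalso].
      pose proof (gap (r x) (2 * m * (1 + T)) (conj (hr x) hgt)) as k.
      destruct (h2 x) as [_ ex]. rewrite ex in k. lra. }
    apply (Rmult_le_reg_r (2 * m)); [lra|].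
    replace ((r x / (2 * m) - 1) * (2 * m)) with (r x - 2 * m) by (field; lra). lra.
  - destruct (good_zeros n a hg) as [l [hnd [hl hm']]].
    set (h := fun s => xs (2 * m * (1 + s))).
    assert (hSh : forall s, 0 < s -> S (h s) = s).
    { intros s hs. unfold S, h. rewrite h1 by nra. field. lra. }
    assert (hhS : forall x, h (S x) = x).
    { intros x. unfold h, S. replace (2 * m * (1 + (r x / (2 * m) - 1))) with (r x) by (field; lra).
      apply h2. }
    exists (map h l). split; [|split].
    + apply NoDup_map_NoDup_ForallPairs; [|exact hnd]. intros s t hs ht e.
      apply hm' in hs as [hs _]. apply hm' in ht as [ht _].
      rewrite <- (hSh s hs), <- (hSh t ht). now rewrite e.
    + now rewrite length_map.
    + intros x. rewrite in_map_iff. split.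
      * intros [s [<- hs]]. apply hm' in hs as [hs e]. unfold W. fold (S (h s)).
        now rewrite hSh.
      * intros e. exists (S x). split; [apply hhS|]. apply hm'. split; [apply hS|exact e].
Qed.

(** * The sequence of horizon values *)

(** Index [k] carries the solution with [k + 1] zeros, whence the shift by [pred] when the sequence
    of the theorem is formed. *)
Fixpoint start_value (k : nat) : R :=
  match k with
  | O => explicit_w 0
  | S k => epsilon (inhabits 0) (fun b => b < start_value k /\ good (S (S k)) b)
  end.

Lemma start_value_step (k : nat) : good (S k) (start_value k) /\ start_value (S k) < start_value k.
Proof.
  assert (K : forall i, good (S i) (start_value i) ->
            start_value (S i) < start_value i /\ good (S (S i)) (start_value (S i))).
  { intros i hi. exact (epsilon_spec (inhabits 0)
      (fun b => b < start_value i /\ good (S (S i)) b) (good_next _ _ hi)). }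
  assert (G : forall i, good (S i) (start_value i)).
  { induction i as [|i IH]; [apply good_explicit|now apply K]. }
  split; [apply G|now apply K].
Qed.

Theorem theorem2 (m : R) (hm : 0 < m) (r : R -> R) (hr : tortoise_radius m r) :
  exists (a : nat -> R) (W : nat -> R -> R),
    a 1%nat = (1 + sqrt 3) / (3 * sqrt 3 + 5) /\
    (forall n : nat, (1 <= n)%nat -> 0 < a n /\ a (S n) < a n) /\
    (forall n : nat, (1 <= n)%nat ->
       smooth_stationary_solution m r (W n) /\
       (forall x : R, -1 <= W n x <= 1) /\
       is_lim (W n) m_infty (Finite (a n)) /\
       is_lim (W n) p_infty (Finite ((-1) ^ n)) /\
       has_exactly_n_zeros (W n) n).
Proof.
  exists (fun n => start_value (pred n)),
    (fun n x => profile (start_value (pred n)) (r x / (2 * m) - 1)).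
  split; [exact explicit_w_start|split].
  - intros [|n] hn; [lia|]. destruct (start_value_step n) as [[[h _] _] h']. now split.
  - intros [|n] hn; [lia|].
    apply (stationary_of_good m r (S n) (start_value n) hm hr), start_value_step.
Qed.
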